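(* Let $n\ge 2$ and $m\ge 0$ be fixed integers with $n-m\ge 2$. Let $U_1,\dots,U_n$ be random variables, each uniform on $(0,1)$, with $U_{m+1}=U_{m+2}=\cdots=U_n$, and let $X_i=\overline{F}^{-1}(U_i)$, where $F$ is a continuous subexponential distribution function. Assume: (a) there exist positive constants $t_0$ and $M$ such that, for all $t>t_0$ and all $j\in\{2,\dots,m+1\}$, $$\sup_{t_0\le x\le t}\frac{\boldsymbol{P}\left(\sum_{i=1}^{j-1}X_i^+>t-x\mid X_j=x\right)}{\boldsymbol{P}\left(\sum_{i=1}^{j-1}X_i^+>t-x\right)}\le M,\qquad X_i^+=\max(X_i,0);$$ (b) the (possibly random, possibly mutually dependent) weights $w_1,\dots,w_n$ satisfy $\boldsymbol{P}(0<w_i<1)=1$ for all $i$, $\sum_{i=1}^n\boldsymbol{E}w_i=1$, and $\{w_i\}_{i=1}^n$ is independent of $\{X_i\}_{i=1}^n$; (c) for every $b>0$ and every $h\in\mathcal{H}(F)$, $$\lim_{t\to\infty}\ \sup_{x\in(0,b]}\frac{F(-h(t)/x)}{\overline{F}(t/x)}=0 .$$ Then, as $t\to\infty$, $$\boldsymbol{P}\left(\sum_{i=1}^n w_iX_i>t\right)\sim \sum_{i=1}^{m}\boldsymbol{P}(w_iX_i>t)+\boldsymbol{P}\left(\Big(\sum_{i=m+1}^n w_i\Big)X_{m+1}>t\right)$$ and $$\boldsymbol{P}\left(\max_{1\le i\le n} w_iX_i>t\right)\sim \sum_{i=1}^{m}\boldsymbol{P}(w_iX_i>t)+\boldsymbol{P}\left(\Big(\max_{m+1\le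 i\le n} w_i\Big)X_{m+1}>t\right).$$
   Context: $F$ is a continuous distribution function on $\mathbb{R}$, $\overline F=1-F$, and $\overline F^{-1}$ is the (well-defined) inverse of $\overline F$; each $X_i$ has distribution function $F$. $f(t)\sim g(t)$ as $t\to\infty$ means $\lim_{t\to\infty}f(t)/g(t)=1$. $F$ is long-tailed if $\overline F(s)>0$ for all $s$ and $\overline F(t+s)\sim\overline F(t)$ as $t\to\infty$ for every $s>0$. $F$ is subexponential if it is long-tailed and, for independent $Z_1,\dots,Z_k$ with common distribution function $F$, $\boldsymbol{P}(Z_1+\cdots+Z_k>t)\sim k\,\overline F(t)$ as $t\to\infty$. $\mathcal{H}(F)$ is the set of functions $h$ on $[0,\infty)$ with $h(t)\uparrow\infty$, $h(t)/t\downarrow 0$ and $\overline F(t-h(t))\sim\overline F(t)$ as $t\to\infty$ (nonempty for long-tailed $F$). *)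

(* Defs.v *)
From HB Require Import structures.
From mathcomp Require Import all_boot all_order all_algebra.
From mathcomp Require Import all_classical all_reals all_analysis.
Set Implicit Arguments.
Unset Strict Implicit.
Unset Printing Implicit Defensive.
Import Order.TTheory GRing.Theory Num.Theory.
Import numFieldNormedType.Exports.
Local Open Scope classical_set_scope.
Local Open Scope ring_scope.

(* Finite families indexed by 1, ..., n are functions on nat of which only the
   values at 1 <= i <= n matter. *)

Definition prob d (T : measurableType d) (R : realType) (P : probability T R)
    (A : set T) : R := fine (P A).

Definition asymp_equiv (R : realType) (f g : R -> R) : Prop :=
  f t / g t @[t --> +oo] --> (1 : R).

Definition tail (R : realType) (F : R -> R) (t : R) : R := 1 - F t.

(* The generalized inverse; F need not be strictly increasing. For F continuous
   and 0 < u < 1 the set is nonempty and bounded below, and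
   tail F (tail_inv F u) = u. Off (0, 1) the value is irrelevant. *)
Definition tail_inv (R : realType) (F : R -> R) (u : R) : R :=
  inf [set x | tail F x <= u].

(* For a finite family the product rule for subfamilies is the case A i = setT. *)
Definition mutually_independent d (T : measurableType d) (R : realType)
    (P : probability T R) (k : nat) (Z : nat -> T -> R) : Prop :=
  forall A : nat -> set R, (forall i, measurable (A i)) ->
    prob P (\bigcap_(i in [set i | (1 <= i <= k)%N]) (Z i @^-1` A i)) =
    \prod_(1 <= i < k.+1) prob P (Z i @^-1` A i).

Definition sigma_family d (T : measurableType d) (R : realType)
    (n : nat) (Y : nat -> T -> R) : set (set T) :=
  <<s \bigcup_(i in [set i | (1 <= i <= n)%N])
        preimage_set_system setT (Y i) measurable >>.

Definition independent_families d (T : measurableType d) (R : realType)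
    (P : probability T R) (n : nat) (Y Z : nat -> T -> R) : Prop :=
  forall A B : set T, sigma_family n Y A -> sigma_family n Z B ->
    P (A `&` B) = (P A * P B)%E.

Definition long_tailed (R : realType) (F : R -> R) : Prop :=
  (forall s : R, 0 < tail F s) /\
  (forall s : R, 0 < s -> asymp_equiv (fun t => tail F (t + s)) (tail F)).

Definition subexponential (R : realType) (F : R -> R) : Prop :=
  long_tailed F /\
  forall (k : nat) (d : measure_display) (T : measurableType d)
         (P : probability T R) (Z : nat -> {RV P >-> R}),
    (1 <= k)%N ->
    mutually_independent P k (fun i => Z i) ->
    (forall i, (1 <= i <= k)%N -> forall x, cdf (Z i) x = (F x)%:E) ->
    asymp_equiv (fun t => prob P [set z | t < \sum_(1 <= i < k.+1) Z i z])
                (fun t => k%:R * tail F t).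

(* Only the values of h on [0, oo) are constrained. *)
Definition H_class (R : realType) (F : R -> R) (h : R -> R) : Prop :=
  [/\ forall s t : R, 0 <= s -> s <= t -> h s <= h t,
      h t @[t --> +oo] --> +oo,
      forall s t : R, 0 < s -> s <= t -> h t / t <= h s / s,
      h t / t @[t --> +oo] --> (0 : R)
    & asymp_equiv (fun t => tail F (t - h t)) (tail F)].

(* K is a regular version of the conditional law of S given Y. *)
Definition is_cond_law d (T : measurableType d) (R : realType)
    (P : probability T R) (S : T -> R) (Y : {RV P >-> R})
    (K : R.-pker R ~> R) : Prop :=
  forall A B : set R, measurable A -> measurable B ->
    P (S @^-1` A `&` Y @^-1` B) =
    (\int[distribution P Y]_(y in B) K y A)%E.

Definition pos_sum (T : Type) (R : realType) (X : nat -> T -> R) (j : nat)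
    (z : T) : R := \sum_(1 <= i < j) Num.max (X i z) 0.

(* Conditional probabilities given X j = x are taken in some version of the
   conditional law, since the event X j = x is null. *)
Definition cond_tail_bound d (T : measurableType d) (R : realType)
    (P : probability T R) (m : nat) (X : nat -> {RV P >-> R}) : Prop :=
  exists t0 M : R, [/\ 0 < t0, 0 < M &
    forall j, (2 <= j <= m.+1)%N ->
    exists K : R.-pker R ~> R,
      is_cond_law (pos_sum X j) (X j) K /\
      forall t, t0 < t ->
        (ereal_sup
          [set (fine (K x `]t - x, +oo[%classic)
                / prob P [set z | t - x < pos_sum X j z])%:E
          | x in `[t0, t]] <= M%:E)%E].

(* The supremum is an extended real: it may be infinite for some t, where the
   real-valued sup would silently be 0. *)
Definition left_tail_negligible (R : realType) (F : R -> R) : Prop :=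
  forall (b : R) (h : R -> R), 0 < b -> H_class F h ->
    ereal_sup [set (F (- h t / x) / tail F (t / x))%:E | x in `]0, b]]
      @[t --> +oo] --> 0%E.

(* Maximum of f i over a <= i <= b, for a <= b; starting the iteration at f a
   is harmless. *)
Definition max_from_to (R : realType) (a b : nat) (f : nat -> R) : R :=
  \big[Num.max/f a]_(a <= i < b.+1) f i.

(* Main.v *)
From HB Require Import structures.
Require Import Defs.
From mathcomp Require Import all_boot all_order all_algebra.
From mathcomp Require Import all_classical all_reals all_analysis.
From mathcomp Require Import measurable_realfun lra ring.
Import Order.TTheory GRing.Theory Num.Theory.
Import numFieldNormedType.Exports.
Local Open Scope classical_set_scope.
Local Open Scope ring_scope.
Set Implicit Arguments.
Unset Strict Implicit.
Unset Printing Implicit Defensive.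

(** Only X_1, ..., X_(m+1) matter: almost surely X_i = X_(m+1) for i > m, so
    that the statement is about N = m + 1 variables with weights theta_i = w_i
    for i <= m, where theta_N is the sum, resp. the maximum, of w_(m+1), ...,
    w_n.  These weights are positive, bounded by a constant b and independent
    of the X_i, but not bounded away from 0.  With D(t) the sum of the
    P(theta_i X_i > t), both claims follow from matching bounds.

    Dependence.  Assumption (a) says that, for a set B of large values,
    P(S_j > s, X_j in B) <= M P(S_j > s) P(X_j in B), where S_j is the sum of
    the positive parts of X_1, ..., X_(j-1) ([cond_tail_bound_quasi_indep]).
    Up to the factor M, this lets S_j and X_j be compared with an independent
    pair, for which subexponentiality says that
    P(X' + X'' > s, X' > L, X'' > L) is at most e P(X' > s) when L and s are
    large ([pair_both_large], [sum_both_large]).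

    Upper bound.  For constant weights in an interval [eta, b] with eta > 0, an
    induction on the number of terms gives
    P(sum of c_i X_i^+ > t) <= (1 + e) (sum of the P(X_i > t / c_i)), uniformly
    in the weights ([pos_wsum_upper]): either the last term or the sum of the
    others is within a constant of t, which long-tailedness absorbs, or both
    are large.
    This uniformity fails as eta tends to 0.  But replacing theta_i by
    max(theta_i, eta) only increases the sum of positive parts, and it changes
    P(theta_i X_i > t) by a factor at most 1 + P(theta_i <= eta) /
    P(theta_i > eta), because on theta_i <= eta the relevant event is
    X_i > t / eta, which already has its share of probability on theta_i > eta
    ([lifted_weight_le], [sum_upper]).

    Lower bound.  Events theta_i X_i > t overlap negligibly, by the dependence
    bound ([overlap_le]), which settles the maximum ([max_asymp]).  For the sum,
    choose h in the class H of the statement such that moreover the tail of F is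
    insensitive to every multiple of h ([insensitive_function]).  If some
    theta_i X_i exceeds t + N h(t) and no term is below - h(t), then the sum
    exceeds t.  The shift by N h(t) costs a factor close to 1
    ([sum_of_tails_shift]), and assumption (c) makes terms below - h(t)
    negligible against D(t) ([left_part_le], [sum_asymp]). *)

(** * Probabilities of events *)

Section measurable_events.
Context (R : realType) d (T : measurableType d).
Implicit Types f g : T -> R.

Lemma measurable_ltset f g : measurable_fun setT f -> measurable_fun setT g ->
  measurable [set z | f z < g z].
Proof.
move=> mf mg; have := measurable_fun_ltr mf mg => /(_ measurableT [set true]).
by rewrite setTI; apply.
Qed.

Lemma measurable_leset f g : measurable_fun setT f -> measurable_fun setT g ->
  measurable [set z | f z <= g z].
Proof.
move=> mf mg; have := measurable_fun_ler mf mg => /(_ measurableT [set true]).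
by rewrite setTI; apply.
Qed.

Lemma measurable_andset (A B : set T) : measurable A -> measurable B ->
  measurable [set z | A z /\ B z].
Proof. exact: measurableI. Qed.

Lemma measurable_exset (A : nat -> set T) a b : (forall i, measurable (A i)) ->
  measurable [set z | exists2 i, (a <= i <= b)%N & A i z].
Proof. by move=> mA; apply: bigcup_measurable => i _. Qed.

End measurable_events.

Section prob_toolbox.
Context (R : realType) d (T : measurableType d) (P : probability T R).
Implicit Types A B : set T.

Lemma probE A : measurable A -> P A = (prob P A)%:E.
Proof. by move=> mA; rewrite /prob fineK// fin_num_measure. Qed.

Lemma prob_ge0 A : 0 <= prob P A.
Proof. by rewrite /prob fine_ge0. Qed.

Lemma le_prob A B : measurable A -> measurable B -> A `<=` B ->
  prob P A <= prob P B.
Proof.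
by move=> mA mB AB; rewrite -lee_fin -!probE//; apply: le_measure => //; rewrite inE.
Qed.

Lemma probU A B : measurable A -> measurable B ->
  prob P (A `|` B) <= prob P A + prob P B.
Proof.
move=> mA mB; rewrite -lee_fin EFinD -!probE//; last exact: measurableU.
exact: measureU2.
Qed.

Lemma prob_split A B : measurable A -> measurable B ->
  prob P A = prob P (A `&` B) + prob P (A `\` B).
Proof.
move=> mA mB; apply: EFin_inj; rewrite EFinD -!probE//.
- by rewrite addeC -measureDI.
- exact: measurableD.
- exact: measurableI.
Qed.

Lemma prob_sum (n : nat) (A : nat -> set T) B :
  (forall i, measurable (A i)) -> measurable B ->
  (forall z, B z -> exists2 i, (1 <= i <= n)%N & A i z) ->
  prob P B <= \sum_(1 <= i < n.+1) prob P (A i).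
Proof.
elim: n B => [|n IHn] B mA mB BA.
  rewrite big_nil [B](_ : _ = set0) /prob ?measure0//.
  by apply/seteqP; split => z // /BA[[|i]].
rewrite big_nat_recr//= (prob_split mB (mA n.+1)) addrC lerD//.
  by apply: le_prob => //; exact: measurableI.
apply: (IHn _ mA); first exact: measurableD.
move=> z [/BA[i /andP[i1 iN] Ai] nA]; exists i => //; rewrite i1/= -ltnS ltn_neqAle iN
  andbT.
by apply/eqP => iE; apply: nA; rewrite -iE.
Qed.

Lemma eq_prob_ae A B : measurable A -> measurable B ->
  {ae P, forall z, A z <-> B z} -> prob P A = prob P B.
Proof.
move=> mA mB [N [mN N0 AB]].
have probDN (C : set T) : measurable C -> prob P C = prob P (C `\` N).
  move=> mC; rewrite (prob_split mC mN) -[RHS]add0r; congr +%R.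
  apply/eqP; rewrite eq_le prob_ge0 andbT.
  have <- : prob P N = 0 by rewrite /prob N0.
  by apply: le_prob => //; exact: measurableI.
rewrite (probDN _ mA) (probDN _ mB); congr prob.
apply/seteqP; split => z [ABz Nz]; split => //; apply: contrapT => H; apply: Nz;
by apply: AB => /= -[H1 H2]; apply: H; auto.
Qed.

End prob_toolbox.

(** Comparison of two probability spaces through countably many pieces; it
    replaces a disintegration of the joint law when only a bound is wanted. *)
Lemma prob_cover_le (R : realType) d (T : measurableType d) (P : probability T R)
  d' (T' : measurableType d') (Q : probability T' R)
  (A : nat -> set T) (B : nat -> set T') (K : R) (D : set T) (E : set T') :
  (forall k, measurable (A k)) -> (forall k, measurable (B k)) ->
  measurable D -> measurable E -> 0 <= K -> trivIset setT B ->
  (forall k, prob P (A k) <= K * prob Q (B k)) ->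
  D `<=` \bigcup_k A k -> \bigcup_k B k `<=` E ->
  prob P D <= K * prob Q E.
Proof.
move=> mA mB mD mE K0 tB AB DA BE.
rewrite -lee_fin EFinM -!probE//.
apply: (le_trans (@measure_sigma_subadditive _ _ _ P D A mA mD DA)).
apply: (@le_trans _ _ (\sum_(0 <= i <oo) (K%:E * Q (B i)))%E).
  by apply: lee_nneseries => // i _; have := AB i; rewrite -lee_fin EFinM -!probE.
rewrite nneseriesZl; last by move=> i _; exact: measure_ge0.
rewrite lee_wpmul2l ?lee_fin// -measure_semi_bigcup//; last exact: bigcup_measurable.
by apply: le_measure => //; rewrite inE//; exact: bigcup_measurable.
Qed.

Lemma prob_gt_vanish (R : realType) d (T : measurableType d) (P : probability T R)
  (f : T -> R) (e : R) : measurable_fun setT f -> 0 < e ->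
  exists t1, forall t, t1 <= t -> prob P [set z | t < f z] <= e.
Proof.
move=> mf e0; pose A (n : nat) := [set z | n%:R < f z].
have mA x : measurable [set z | x < f z] by exact: measurable_ltset.
have A0 : \bigcap_n A n = set0.
  apply/seteqP; split => // z Az.
  by have := Az (Num.Def.truncn (f z)).+1 I; rewrite /A/= ltNge ltW// truncnS_gt.
have : P (A n) @[n --> \oo] --> P (\bigcap_n A n).
  apply: nonincreasing_cvg_mu => //.
  - by rewrite ltey_eq fin_num_measure//; exact: mA.
  - by move=> n; exact: mA.
  - by rewrite A0.
  - move=> m n mn; apply/subsetPset => z; rewrite /A/=; apply: le_lt_trans.
    by rewrite ler_nat.
rewrite A0 measure0 => /fine_cvgP[_] /cvgrPdist_le /(_ e e0)[n _ /(_ n (leqnn n))] /=.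
rewrite sub0r normrN => /(le_trans (ler_norm _)) Ak.
exists n%:R => t nt; apply: le_trans Ak.
by apply: le_prob; [exact: mA|exact: mA|move=> z /=; exact: le_lt_trans].
Qed.

(** * Integrating out independent weights *)

Section independence.
Context (R : realType) d (T : measurableType d) (P : probability T R).
Context d1 (T1 : measurableType d1) d2 (T2 : measurableType d2).
Variables (f1 : {mfun T >-> T1}) (f2 : {mfun T >-> T2}).
Hypothesis f12 : forall A B, measurable A -> measurable B ->
  P (f1 @^-1` A `&` f2 @^-1` B) = (P (f1 @^-1` A) * P (f2 @^-1` B))%E.

Let f12p (z : T) : T1 * T2 := (f1 z, f2 z).

Let mf12 : measurable_fun setT f12p.
Proof. exact/measurable_fun_pair. Qed.

HB.instance Definition _ := @isMeasurableFun.Build _ _ _ _ f12p mf12.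

Let P1 : probability T1 R := distribution P f1.
Let P2 : probability T2 R := distribution P f2.

Let pairE (A : set (T1 * T2)) : measurable A ->
  P [set z | A (f1 z, f2 z)] = (P1 \x P2)%E A.
Proof.
by move=> mA; rewrite (@product_measure_unique _ _ _ _ _ P1 P2 (distribution P f12p)).
Qed.

(** Fubini: the joint law of [(f1, f2)] is the product of the marginals, so a
    bound that holds for each frozen value [c] of [f1] can be integrated. *)
Lemma indep_prob_le (A : set (T1 * T2)) (N : nat) (B : nat -> set (T1 * T2)) (a : R) :
  measurable A -> (forall i, (1 <= i < N)%N -> measurable (B i)) -> 0 <= a ->
  (forall c, prob P [set z | A (c, f2 z)] <=
     a * \sum_(1 <= i < N) prob P [set z | B i (c, f2 z)]) ->
  prob P [set z | A (f1 z, f2 z)] <=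
     a * \sum_(1 <= i < N) prob P [set z | B i (f1 z, f2 z)].
Proof.
move=> mA mB a0 AB.
have mD (C : set (T1 * T2)) : measurable C -> measurable [set z | C (f12p z)].
  by move=> mC; rewrite -[X in measurable X]setTI; exact: mf12.
have mS (C : set (T1 * T2)) c : measurable C -> measurable [set z | C (c, f2 z)].
  move=> mC; have mCc := measurable_xsection c mC.
  have mf2 : measurable_fun setT f2 by exact: measurable_funPT.
  rewrite [X in measurable X](_ : _ = setT `&` f2 @^-1` xsection C c); first exact: mf2.
  by rewrite setTI; apply/seteqP; split => u /=; rewrite /xsection/= inE.
rewrite -lee_fin -probE; last exact: mD.
rewrite pairE// /product_measure1.
have -> : (a * \sum_(1 <= i < N) prob P [set z | B i (f1 z, f2 z)])%:E =
  (a%:E * \sum_(1 <= i < N) \int[P1]_x (P2 \o xsection (B i)) x)%E.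
  rewrite EFinM -sumEFin; congr (_ * _)%E.
  apply: eq_big_nat => i iN.
  by rewrite -probE; [apply: pairE; exact: mB|apply: mD; exact: mB].
have xE (C : set (T1 * T2)) c : (P2 \o xsection C) c = P [set z | C (c, f2 z)].
  rewrite /= /P2 /distribution /pushforward/=; congr (P _).
  by apply/seteqP; split => u /=; rewrite /xsection/= inE.
have mX i : (1 <= i < N)%N -> measurable_fun setT (P2 \o xsection (B i) : T1 -> \bar R).
  by move=> iN; apply: measurable_fun_xsection; exact: mB.
have -> : (\sum_(1 <= i < N) \int[P1]_x (P2 \o xsection (B i)) x =
   \int[P1]_x \sum_(1 <= i < N) (if (1 <= i < N)%N then (P2 \o xsection (B i)) x else
     0))%E.
  rewrite ge0_integral_sum//; first last.
  - by move=> i x _; case: ifP.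
  - by move=> i; case iN: (1 <= i < N)%N => //; exact: mX.
  by apply: eq_big_nat => i iN; rewrite iN.
rewrite -ge0_integralZl//; first last.
- by move=> x _; apply: sume_ge0 => i _; case: ifP.
- by apply: emeasurable_sum => i; case iN: (1 <= i < N)%N => //; exact: mX.
apply: ge0_le_integral => //.
- exact: measurable_fun_xsection.
- by apply: measurable_funeM; apply: emeasurable_sum => i; case iN: (1 <= i < N)%N => //;
  exact: mX.
move=> x _; rewrite xE probE; last exact: mS.
rewrite (_ : (\sum_(1 <= i < N) _)%E = (\sum_(1 <= i < N) prob P [set z | B i (x, f2
  z)])%:E).
  by rewrite -EFinM lee_fin.
rewrite -sumEFin; apply: eq_big_nat => i iN; rewrite iN xE probE//.
by apply: mS; exact: mB.
Qed.

End independence.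

(** * Long-tailed functions *)

Section asymptotics.
Context (R : realType).
Implicit Types f g F : R -> R.

Lemma asymp_equiv_near f g (e : R) : asymp_equiv f g -> 0 < e ->
  exists t0, forall t, t0 <= t -> `|f t / g t - 1| <= e.
Proof.
move=> /cvgrPdist_le/(_ e) + e0 => /(_ e0)[M [_ MP]].
by exists (M + 1) => t tM; rewrite distrC; apply: MP; rewrite (lt_le_trans _ tM)// ltrDl.
Qed.

Lemma asymp_equiv_squeeze f g :
  (forall e, 0 < e -> e <= 1 -> exists t0, forall t, t0 <= t ->
     [/\ 0 < g t, f t <= (1 + e) * g t & g t <= (1 + e) * f t]) ->
  asymp_equiv f g.
Proof.
move=> H; apply/cvgrPdist_le => e e0.
pose e' := Num.min e 1.
have e'0 : 0 < e' by rewrite lt_min e0/=.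
have [|t0 H0] := H e' e'0; first by rewrite ge_min lexx orbT.
exists t0; split; first exact: num_real.
move=> t /ltW/H0[g0 fg gf]; apply: (@le_trans _ _ e'); last by rewrite ge_min lexx.
have -> : 1 - f t / g t = (g t - f t) / g t by field; rewrite gt_eqF.
rewrite normrM normfV (gtr0_norm g0) ler_pdivrMr//.
have e'1 : e' <= 1 by rewrite ge_min lexx orbT.
by rewrite ler_norml; apply/andP; split; nra.
Qed.

Section tail.
Variable F : R -> R.
Hypothesis ndF : {homo F : x y / x <= y}.
Hypothesis Flong : long_tailed F.

Lemma tail_gt0 t : 0 < tail F t.
Proof. by case: Flong. Qed.

Lemma le_tail s t : s <= t -> tail F t <= tail F s.
Proof. by move=> /ndF; rewrite /tail; lra. Qed.

(** The definition shifts to the right; translating [t] turns this into a bound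
    for shifts to the left, which is how the tail enters the estimates. *)
Lemma long_tailed_shift (K e : R) : 0 < e ->
  exists t0, forall t, t0 <= t -> tail F (t - K) <= (1 + e) * tail F t.
Proof.
move=> e0; have [K0|K0] := leP K 0.
  exists 0 => t _; have := tail_gt0 t.
  have : tail F (t - K) <= tail F t by apply: le_tail; lra.
  by nra.
have [t0 H0] := @asymp_equiv_near _ _ (e / (1 + e)) (Flong.2 K K0) ltac:(by rewrite
  divr_gt0//; lra).
exists (t0 + K) => t tt; have {H0} := H0 (t - K); rewrite subrK lerBrDr => /(_ tt).
have g0 := tail_gt0 (t - K).
rewrite ler_norml => /andP[+ _].
have -> : - (e / (1 + e)) = 1 / (1 + e) - 1 by field; rewrite gt_eqF//; lra.
rewrite lerD2r ler_pdivlMr// mul1r mulrC ler_pdivrMr; last lra.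
by rewrite mulrC.
Qed.

(** Any multiple of [h] being allowed is more than membership in the class asks.
    The function is the infimum of the lines [k + t / T k]: such an infimum is
    nondecreasing with nonincreasing slope [h t / t] whatever [T] is, it tends to
    infinity while [h t / t] tends to 0 as soon as [T] tends to infinity, and it
    is at most [k + 2] up to [T k.+1].  It then suffices to let [T k] be so large
    that beyond it a shift by [(k + 2) ^ 2] changes the tail by a factor at most
    [1 + 1 / (k + 1)]. *)
Lemma insensitive_function :
  exists h, H_class F h /\
   forall K e : R, 0 < e -> exists t0, forall t, t0 <= t ->
     tail F t <= (1 + e) * tail F (t + K * h t).
Proof.
have /choice[a aP] (k : nat) : exists a, forall t, a <= t ->
    tail F (t - k.+2%:R ^+ 2) <= (1 + k.+1%:R^-1) * tail F t.
  by apply: long_tailed_shift; rewrite invr_gt0.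
pose T k := \sum_(i < k.+1) (`|a i| + 1).
have TS k : T k.+1 = T k + (`|a k.+1| + 1) by rewrite /T big_ord_recr.
have ndT : {homo T : i j / (i <= j)%N >-> i <= j}.
  apply: homo_leq => //; first exact: le_trans.
  by move=> i; rewrite TS lerDl addr_ge0.
have Tk k : k.+1%:R <= T k.
  elim: k => [|k IH]; first by rewrite /T big_ord1 lerDr.
  by rewrite TS -natr1 lerD// lerDr.
have T0 k : 0 < T k by rewrite (lt_le_trans _ (Tk k)).
have aT k : a k <= T k.
  rewrite /T big_ord_recr/= (le_trans (ler_norm _))// addrCA lerDl addr_ge0//.
  by apply: sumr_ge0 => i _; rewrite addr_ge0.
pose E t := range (fun k : nat => k%:R + t / T k).
pose h t := inf (E t).
have E0 t : E t !=set0 by exists (0%:R + t / T 0); exists 0%N.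
have Elb t : 0 <= t -> lbound (E t) 0.
  by move=> t0 _ [k _ <-]; rewrite addr_ge0// divr_ge0// ltW.
have hub t k : 0 <= t -> h t <= k%:R + t / T k.
  by move=> t0; apply: ge_inf; [exists 0; exact: Elb|exists k].
have hlb t x : (forall k, x <= k%:R + t / T k) -> x <= h t.
  by move=> H; apply: lb_le_inf => // _ [k _ <-].
have h0 t : 0 <= t -> 0 <= h t by move=> t0; apply: lb_le_inf => //; exact: Elb.
have hT k t : T k <= t -> exists2 k', (k <= k')%N & T k' <= t /\ h t <= k'.+2%:R.
  move=> kt; have t0 : 0 <= t by rewrite (le_trans _ kt)// ltW.
  have ex : exists n, t < T n.
    exists (Num.Def.truncn t); rewrite (lt_le_trans _ (Tk _))//.
    exact: truncnS_gt.
  case: (ex_minnP ex) => -[|n] nt nmin.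
    by have := ndT 0%N k (leq0n _); rewrite leNgt (le_lt_trans kt).
  have nt' : T n <= t by rewrite leNgt; apply/negP => /nmin; rewrite ltnn.
  exists n; last first.
    split=> //; rewrite (le_trans (hub t n.+1 t0))// -[leRHS]natr1 lerD2l.
    by rewrite ler_pdivrMr// mul1r ltW.
  by rewrite leqNgt; apply/negP => /ndT; rewrite leNgt (le_lt_trans kt).
have hmain (K e : R) : 0 < e -> exists2 t0, 0 < t0 & forall t, t0 <= t ->
    forall s, t <= s -> tail F (s - K * h t) <= (1 + e) * tail F s.
  move=> e0; pose k := maxn (Num.Def.truncn e^-1) (Num.Def.truncn `|K|).
  have ek : k.+1%:R^-1 <= e.
    rewrite invf_ple ?posrE// ltW// (@lt_le_trans _ _ (Num.Def.truncn e^-1).+1%:R)//.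
      exact: truncnS_gt.
    by rewrite ler_nat ltnS leq_maxl.
  have Kk : K <= k.+2%:R.
    rewrite (le_trans (ler_norm _))// ltW// (@lt_le_trans _ _ (Num.Def.truncn
      `|K|).+1%:R)//.
      exact: truncnS_gt.
    by rewrite ler_nat ltnS leqW// leq_maxr.
  exists (T k) => // t kt s ts; have [k' kk' [Tt ht]] := hT _ _ kt.
  have t0 : 0 <= t by rewrite (le_trans _ kt)// ltW.
  apply: (@le_trans _ _ (tail F (s - k'.+2%:R ^+ 2))).
    apply: le_tail; rewrite lerD2l lerN2 expr2.
    have K' : K <= k'.+2%:R by rewrite (le_trans Kk)// ler_nat !ltnS.
    have := h0 _ t0; have : 0 <= k'.+2%:R :> R by []. nra.
  rewrite (le_trans (aP k' _ _))//; first by rewrite (le_trans (aT _))// (le_trans Tt).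
  rewrite ler_wpM2r ?(ltW (tail_gt0 _))// lerD2l (le_trans _ ek)//.
  by rewrite lef_pV2 ?posrE// ler_nat ltnS.
exists h; split; last first.
  move=> K e e0; have [K0|K0] := leP K 0.
    exists 0 => t t0; have := tail_gt0 t.
    have : tail F t <= tail F (t + K * h t) by apply: le_tail; have := h0 _ t0; nra.
    by nra.
  have [t0 t00 H] := hmain K e e0; exists t0 => t tt.
  have t1 : 0 <= t by rewrite (le_trans _ tt)// ltW.
  have := H t tt (t + K * h t); rewrite addrK; apply.
  by rewrite lerDl mulr_ge0// ?h0// ltW.
split.
- move=> s t s0 st; apply: hlb => k.
  by rewrite (le_trans (hub s k s0))// lerD2l ler_pM2r// invr_gt0.
- apply/cvgryPge => A; pose k := (Num.Def.truncn `|A|).+1.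
  have Ak : A <= k%:R.
    by rewrite (le_trans (ler_norm _))// ltW// truncnS_gt.
  exists (k%:R * T k); split; first exact: num_real.
  move=> t /ltW tk; apply: hlb => j; have t0 : 0 <= t by rewrite (le_trans _ tk)//
    mulr_ge0// ltW.
  rewrite (le_trans Ak)//; have [jk|kj] := leqP j k.
    rewrite (@le_trans _ _ (t / T j))// ?lerDr// ler_pdivlMr// (le_trans _ tk)//.
    by rewrite ler_wpM2l// ndT.
  by rewrite (@le_trans _ _ j%:R)// ?lerDl ?ler_nat 1?ltnW// divr_ge0// ltW.
- move=> s t s0 st; have t0 : 0 < t by exact: lt_le_trans st.
  rewrite ler_pdivlMr// mulrAC ler_pdivrMr//; apply: (@le_trans _ _ (h s * t)) => //.
  rewrite -ler_pdivrMr//; apply: hlb => k.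
  rewrite ler_pdivrMr// (le_trans (ler_wpM2r (ltW s0) (hub t k (ltW t0))))//.
  rewrite !mulrDl lerD//; first by rewrite ler_wpM2l.
  by have -> : t / T k * s = s / T k * t by ring.
- apply/cvgrPdist_le => e e0; pose k := (Num.Def.truncn (2 / e)).
  have ek : 2 / e <= T k.
    rewrite (le_trans _ (Tk k))// ltW//.
    exact: truncnS_gt.
  exists (Num.max (1) (2 * k%:R / e)); split; first exact: num_real.
  move=> t; rewrite gt_max => /andP[t1 tk]; have t0 : 0 < t by exact: lt_trans t1.
  rewrite sub0r normrN ger0_norm; last by rewrite divr_ge0// ?h0// ltW.
  rewrite ler_pdivrMr// (le_trans (hub t k (ltW t0)))//.
  have : t / T k <= e / 2 * t.
    rewrite mulrC ler_wpM2r ?(ltW t0)// invf_ple ?posrE ?divr_gt0//.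
    by rewrite invfM invrK mulrC.
  move: tk; rewrite ltr_pdivrMr// => tk tT; nra.
- apply: asymp_equiv_squeeze => e e0 e1.
  have [t0 t00 H] := hmain 1 e e0; exists t0 => t tt; split; first exact: tail_gt0.
  + by have := H t tt t (lexx _); rewrite mul1r.
  + have t1 : 0 <= t by rewrite (le_trans _ tt)// ltW.
    have : tail F t <= tail F (t - h t) by apply: le_tail; have := h0 _ t1; lra.
    have := tail_gt0 (t - h t); nra.
Qed.

End tail.
End asymptotics.

(** * Two independent subexponential variables *)

Section independent_pair.
Context (R : realType) d (T : measurableType d) (P : probability T R).
Variables (X : {RV P >-> R}) (F : R -> R).
Hypothesis cdfX : forall x, cdf X x = (F x)%:E.
Hypothesis Fsub : subexponential F.

(** The product space carries two independent copies of [X], to which the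
    definition of subexponentiality applies. *)
Definition square_measure : set (T * T) -> \bar R := (P \x P)%E.
HB.instance Definition _ := Measure.on square_measure.

Let square_setT : square_measure setT = 1%E.
Proof.
by rewrite -setXTT [LHS]product_measure1E// -[RHS]mule1 -(probability_setT P).
Qed.

HB.instance Definition _ :=
  @Measure_isProbability.Build _ _ R square_measure square_setT.

Let mX1 : measurable_fun setT (fun u : T * T => X u.1).
Proof. exact: measurableT_comp. Qed.
Let mX2 : measurable_fun setT (fun u : T * T => X u.2).
Proof. exact: measurableT_comp. Qed.

Let Z1 : {RV square_measure >-> R} :=
  HB.pack (fun u : T * T => X u.1) (isMeasurableFun.Build _ _ _ _ _ mX1).
Let Z2 : {RV square_measure >-> R} :=
  HB.pack (fun u : T * T => X u.2) (isMeasurableFun.Build _ _ _ _ _ mX2).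

Lemma square_prob (A B : set R) : measurable A -> measurable B ->
  prob square_measure [set u | A (X u.1) /\ B (X u.2)] =
  prob P (X @^-1` A) * prob P (X @^-1` B).
Proof.
move=> mA mB.
have mX A' : measurable A' -> measurable (X @^-1` A').
  by move=> mA'; rewrite -[_ @^-1` _]setTI; exact: measurable_funPT.
have H := @product_measure1E _ _ _ _ _ P P _ _ (mX _ mA) (mX _ mB).
apply: EFin_inj; rewrite EFinM -!probE; [exact: H|exact: mX|exact: mX|].
exact: measurableX (mX _ mA) (mX _ mB).
Qed.

Lemma square_fst (A : set R) : measurable A ->
  prob square_measure [set u | A (X u.1)] = prob P (X @^-1` A).
Proof.
move=> mA; have := square_prob mA measurableT.
rewrite preimage_setT [X in _ * X]/prob probability_setT mulr1 => <-.
by congr prob; apply/seteqP; split => u //= -[].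
Qed.

Lemma square_snd (A : set R) : measurable A ->
  prob square_measure [set u | A (X u.2)] = prob P (X @^-1` A).
Proof.
move=> mA; have := square_prob measurableT mA.
rewrite preimage_setT [X in X * _]/prob probability_setT mul1r => <-.
by congr prob; apply/seteqP; split => u //= -[].
Qed.

Lemma cdf_homo : {homo F : x y / x <= y}.
Proof. by move=> x y xy; rewrite -lee_fin -!cdfX; exact: cdf_nondecreasing. Qed.

Lemma prob_le_cdf x : prob P [set z | X z <= x] = F x.
Proof.
apply: EFin_inj; rewrite -probE; last exact: measurable_leset.
by rewrite -cdfX.
Qed.

Lemma prob_gt_tail x : prob P [set z | x < X z] = tail F x.
Proof.
have m1 : measurable [set z | X z <= x] by exact: measurable_leset.
have -> : [set z | x < X z] = ~` [set z | X z <= x].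
  by apply/seteqP; split => z /=; rewrite ltNge => /negP.
rewrite /prob probability_setC// (_ : P _ = (F x)%:E)// -cdfX.
rewrite /cdf /distribution /pushforward; congr (P _).
Qed.

Lemma interval_mass L :
  1 - F (- L) - tail F L <= prob P (X @^-1` `]-L, L]%classic).
Proof.
have mI : measurable (X @^-1` `]-L, L]%classic).
  by rewrite -[_ @^-1` _]setTI; exact: measurable_funPT.
have mle : measurable [set z | X z <= - L] by exact: measurable_leset.
have mgt : measurable [set z | L < X z] by exact: measurable_ltset.
have := prob_split P measurableT mI; rewrite [LHS]/prob probability_setT/= setTI => p1.
have : prob P (~` (X @^-1` `]-L, L]%classic)) <= F (- L) + tail F L.
  rewrite -prob_le_cdf -prob_gt_tail; apply: le_trans (probU P mle mgt).
  apply: le_prob; [exact: measurableC|exact: measurableU|].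
  move=> z /=; rewrite in_itv/= => /negP; rewrite negb_and -leNgt -ltNge => /orP[]; by
    [left|right].
rewrite -setTD; lra.
Qed.

Lemma tails_vanish (e : R) : 0 < e -> exists2 L, 0 < L & F (- L) <= e /\ tail F L <= e.
Proof.
move=> e0.
have cF1 : F x @[x --> +oo] --> (1 : R).
  have := cvg_cdfy1 X; rewrite (_ : cdf X = EFin \o F); last exact/funext.
  by move/fine_cvgP => [_].
have cF0 : F x @[x --> -oo] --> (0 : R).
  have := cvg_cdfNy0 X; rewrite (_ : cdf X = EFin \o F); last exact/funext.
  by move/fine_cvgP => [_].
move/cvgrPdist_le : cF1 => /(_ e e0)[M1 [_ H1]].
move/cvgrPdist_le : cF0 => /(_ e e0)[M2 [_ H2]].
exists (`|M1| + `|M2| + 1); first by rewrite ltr_wpDl.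
split.
  have /= := H2 (- (`|M1| + `|M2| + 1)); rewrite sub0r normrN => H.
  apply: (le_trans (ler_norm _)); apply: H.
  by have := ler_norm (- M2); rewrite normrN; have := normr_ge0 M1; lra.
apply: (le_trans (ler_norm _)); apply: H1 => /=.
by have := ler_norm M1; have := normr_ge0 M2; lra.
Qed.

(** The event [s < X' + X''] has probability about [2 * tail F s].  It contains
    the disjoint events where one variable lies in [-L, L] and the other exceeds
    [s + L], which together already account for almost all of it when [L] is
    large; what is left contains the event that both variables exceed [L]. *)
Lemma pair_both_large (e : R) : 0 < e -> exists L0 s0, forall L s, L0 <= L -> s0 <= s ->
  prob square_measure [set u | [/\ L < X u.1, L < X u.2 & s < X u.1 + X u.2]]
    <= e * tail F s.
Proof.
move=> e0; pose k := Num.min (e / 6) 1.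
have k0 : 0 < k by rewrite lt_min; apply/andP; split; lra.
have k1 : k <= 1 by rewrite ge_min lexx orbT.
have ke : 6 * k <= e by have : k <= e / 6; [rewrite ge_min lexx|lra].
clearbody k; have [L L0 [FL tL]] := @tails_vanish (k / 2) ltac:(lra).
have long : long_tailed F by case: Fsub.
have [s1 H1] := @long_tailed_shift _ F cdf_homo long L k k0.
have indep : mutually_independent square_measure 2
    (fun i => if i == 1%N then Z1 else Z2).
  move=> A mA; rewrite big_nat_recr//= big_nat1/= (square_fst (mA 1%N)) (square_snd (mA
    2%N)).
  rewrite -square_prob//; congr prob; apply/seteqP; split => u /=.
    by move=> H; split; [exact: (H 1%N)|exact: (H 2%N)].
  by move=> [A1 A2] [|[|[|i]]].
have eqd (i : nat) : (1 <= i <= 2)%N -> forall x,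
   cdf (if i == 1%N then Z1 else Z2) x = (F x)%:E.
  move=> _ x; rewrite -prob_le_cdf /cdf /distribution /pushforward probE; last first.
    by rewrite -[_ @^-1` _]setTI; exact: measurable_funPT.
  have mx : measurable `]-oo, x]%classic by [].
  congr EFin; case: ifP => _; [rewrite [LHS](square_fst mx)|rewrite [LHS](square_snd mx)];
  by congr prob; apply/seteqP; split => z /=; rewrite in_itv.
have := Fsub.2 2 _ _ square_measure (fun i => if i == 1%N then Z1 else Z2) isT indep eqd.
move=> /asymp_equiv_near /(_ k0)[s2 H2].
exists L, (Num.max 0 (Num.max s1 s2)) => L' s LL'.
rewrite !ge_max => /and3P[s0 ss1 ss2].
pose A := [set u | s < X u.1 + X u.2].
pose B1 := [set u | `]-L, L]%classic (X u.1) /\ `]s + L, +oo[%classic (X u.2)].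
pose B2 := [set u | `]s + L, +oo[%classic (X u.1) /\ `]-L, L]%classic (X u.2)].
have mXi (i : interval R) (f : T * T -> R) : measurable_fun setT f -> measurable [set u |
  [set` i] (f u)].
  by move=> mf; rewrite -[X in measurable X]setTI; exact: mf.
have mA : measurable A by apply: measurable_ltset => //; exact: measurable_funD.
have mB1 : measurable B1 by apply: measurable_andset; exact: mXi.
have mB2 : measurable B2 by apply: measurable_andset; exact: mXi.
have mC L1 : measurable [set u | [/\ L1 < X u.1, L1 < X u.2 & s < X u.1 + X u.2]].
  rewrite [X in measurable X](_ : _ = ([set u | L1 < X u.1] `&` [set u | L1 < X u.2]) `&`
    A).
    by apply: measurableI => //; apply: measurableI; exact: measurable_ltset.
  by apply/seteqP; split => u; [case|case=> -[]].
apply: (@le_trans _ _ (prob square_measure (A `\` B1 `\` B2))).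
  apply: le_prob => //; first by apply: measurableD => //; exact: measurableD.
  move=> u [/= a b c]; rewrite /B1 /B2 /A /= !in_itv/= !andbT; split; first split => //.
    by move=> [/andP[_]] ? ?; lra.
  by move=> [?] /andP[_] ?; lra.
have p1 : prob P (X @^-1` `]-L, L]%classic) >= 1 - k.
  by have := interval_mass L; lra.
have mI : measurable `]-L, L]%classic by [].
have mJ : measurable `]s + L, +oo[%classic by [].
have gtJ : prob P (X @^-1` `]s + L, +oo[%classic) = tail F (s + L).
  by rewrite -prob_gt_tail; congr prob; apply/seteqP; split => z /=; rewrite in_itv/=
    andbT.
have t0 := tail_gt0 long s.
have := H1 (s + L) ltac:(lra); rewrite addrK => ts.
have t1 : (1 - k) * tail F s <= tail F (s + L).
  have := tail_gt0 long (s + L) => tL0.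
  apply: (@le_trans _ _ ((1 - k) * ((1 + k) * tail F (s + L)))).
    by rewrite ler_wpM2l//; lra.
  nra.
have PB1 : (1 - k) * tail F (s + L) <= prob square_measure (A `&` B1).
  apply: (@le_trans _ _ (prob square_measure B1)).
    by rewrite (square_prob mI mJ) gtJ ler_wpM2r// ltW// tail_gt0.
  apply: le_prob => //; first exact: measurableI.
  move=> u B1u; split=> //; move: B1u; rewrite /B1 /A/= !in_itv/= andbT => -[/andP[]];
    lra.
have PB2 : (1 - k) * tail F (s + L) <= prob square_measure ((A `\` B1) `&` B2).
  apply: (@le_trans _ _ (prob square_measure B2)).
    by rewrite (square_prob mJ mI) gtJ mulrC ler_wpM2l// ltW// tail_gt0.
  apply: le_prob => //; first by apply: measurableI => //; exact: measurableD.
  move=> u B2u; split=> //; move: B2u; rewrite /B1 /B2 /A/= !in_itv/= !andbT => -[+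
    /andP[]] => *.
  by split; [lra|move=> [/andP[]]; lra].
have PA2 : prob square_measure A <= (1 + k) * (2 * tail F s).
  have {H2} := H2 s ss2; have := tail_gt0 long s => ts0.
  rewrite [X in prob _ X](_ : _ = A); last first.
    by apply/seteqP; split => u; rewrite /A/= big_nat_recr//= big_nat1.
  by move=> /(le_trans (ler_norm _)); rewrite lerBlDr addrC ler_pdivrMr// mulr_gt0.
have PA := prob_split square_measure mA mB1.
have PA' := prob_split square_measure (measurableD mA mB1) mB2.
move: PB1 PB2 PA2 PA PA'.
move: (prob _ A) (prob _ (A `\` B1)) (prob _ (A `&` B1)) (prob _ ((A `\` B1) `&` B2)).
move: (prob _ (A `\` B1 `\` B2)) => p0 p2 p3 p4 p5.
clear A B1 B2 mA mB1 mB2 mI mJ gtJ; nra.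
Qed.

End independent_pair.

(** * Uniform upper bound for constant weights *)

Lemma exists_argmax (R : realType) (c : nat -> R) k :
  exists2 i, (1 <= i < k.+2)%N & forall j, (1 <= j < k.+2)%N -> c j <= c i.
Proof.
elim: k => [|k [i /andP[i1 ik] ci]].
  by exists 1%N => // -[|[|j]].
have [cc|cc] := leP (c i) (c k.+2).
  exists k.+2; first by rewrite ltnS leqnn.
  move=> j /andP[j1]; rewrite ltnS leq_eqVlt => /orP[/eqP->//|jk].
  by rewrite (le_trans (ci _ _))// j1.
exists i; first by rewrite i1 ltnW.
move=> j /andP[j1]; rewrite ltnS leq_eqVlt => /orP[/eqP->|jk]; first exact: ltW.
by rewrite ci// j1.
Qed.

Section upper_bound.
Context (R : realType) d (T : measurableType d) (P : probability T R).
Variables (N : nat) (X : nat -> {RV P >-> R}) (F : R -> R).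
Hypothesis cdfX : forall i, (1 <= i <= N)%N -> forall x, cdf (X i) x = (F x)%:E.
Hypothesis Fsub : subexponential F.

Variables t0 M : R.
Hypothesis M0 : 0 < M.
Local Notation S := (pos_sum (fun i => X i)).
Hypothesis quasi_indep : forall j, (2 <= j <= N)%N -> forall s (B : set R), 0 < s ->
  measurable B -> B `<=` `[t0, +oo[%classic ->
  prob P [set z | s < S j z /\ B (X j z)] <=
  M * prob P [set z | s < S j z] * prob P [set z | B (X j z)].

Lemma measurable_pos_sum j : measurable_fun setT (S j).
Proof. by apply: measurable_sum => i; exact: measurable_maxr. Qed.

Let long : long_tailed F. Proof. by case: Fsub. Qed.

(** [S j] has a tail comparable with that of [F], and it is independent of [X j]
    up to the factor [M]; hence the bound for an independent pair carries over. *)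
Lemma sum_both_large j (C s1 e : R) : (1 <= j <= N)%N -> 0 <= C ->
  (forall s, s1 <= s -> prob P [set z | s < S j z] <= C * tail F s) ->
  0 < e -> exists L0 s0, forall L s, L0 <= L -> s0 <= s ->
  prob P [set z | [/\ L < S j z, L < X j z & s < S j z + X j z]] <= e * tail F s.
Proof.
move=> /andP[j1 jN] C0 SC e0; have ndF := cdf_homo (cdfX (i := j) ltac:(by rewrite j1)).
have [j2|j2] := leqP 2 j; last first.
  have -> : j = 1%N by case: j j1 j2 {jN SC ndF} => [|[|j]].
  exists 0, 0 => L s L0 s0; rewrite [X in prob _ X](_ : _ = set0).
    by rewrite /prob measure0 mulr_ge0// ltW// tail_gt0.
  by apply/seteqP; split => // z [/=]; rewrite /pos_sum big_geq//; lra.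
have MC0 : 0 <= M * C by rewrite mulr_ge0// ltW.
pose k := e / (2 * (M * C + 1)).
have k0 : 0 < k by rewrite divr_gt0//; lra.
have [L0 [s0 pair]] := @pair_both_large _ _ _ _ (X j) F (cdfX (i := j) ltac:(by rewrite
  j1)) Fsub k k0.
have [s2 H2] := @long_tailed_shift _ F ndF long 1 1 ltr01.
exists (Num.max (L0 + 1) (Num.max t0 (Num.max s1 1))), (Num.max (s0 + 1) s2) => L s.
rewrite !ge_max => /and4P[LL0 Lt0 Ls1 L1] /andP[ss0 ss2].
have mS := measurable_pos_sum j.
(* Cutting the range of [X j] into unit intervals freezes it up to an error 1,
   which is why the comparison is with the independent pair at [s - 1]. *)
pose I (n : nat) : set R := `[L + n%:R, L + n%:R + 1[%classic.
have mXI (f : T -> R) n : measurable_fun setT f -> measurable [set z | I n (f z)].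
  by move=> mf; rewrite -[X in measurable X]setTI; apply: mf => //; exact: measurable_itv.
pose A n := [set z | Num.max L (s - L - n%:R - 1) < S j z /\ I n (X j z)].
pose B n := [set u : T * T | Num.max L (s - L - n%:R - 1) < X j u.1 /\ I n (X j u.2)].
pose D := [set z | [/\ L < S j z, L < X j z & s < S j z + X j z]].
pose E := [set u : T * T | [/\ L - 1 < X j u.1, L - 1 < X j u.2 & s - 1 < X j u.1 + X j
  u.2]].
have mX1 : measurable_fun setT (fun u : T * T => X j u.1) by exact: measurableT_comp.
have mX2 : measurable_fun setT (fun u : T * T => X j u.2) by exact: measurableT_comp.
suff DE : prob P D <= (M * C) * prob (square_measure P) E.
  have pE := pair (L - 1) (s - 1) ltac:(lra) ltac:(lra).
  have s3 := H2 s ss2; have ts := tail_gt0 long s.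
  apply: (le_trans DE).
  apply: (le_trans (ler_wpM2l MC0 pE)).
  apply: (@le_trans _ _ (M * C * (k * (2 * tail F s)))).
    by rewrite ler_wpM2l// ler_wpM2l// ltW.
  rewrite [leLHS](_ : _ = e * (M * C / (M * C + 1)) * tail F s); last first.
    by rewrite /k; field; rewrite gt_eqF//; lra.
  rewrite ler_wpM2r ?(ltW ts)//.
  by rewrite ler_piMr ?(ltW e0)// ler_pdivrMr; lra.
apply: (@prob_cover_le _ _ _ P _ _ (square_measure P) A B) => //.
- by move=> n; apply: measurable_andset; [exact: measurable_ltset|exact: mXI].
- move=> n; apply: measurable_andset; first exact: measurable_ltset.
  by rewrite -[X in measurable X]setTI; apply: mX2 => //; exact: measurable_itv.
- have -> : D = ([set z | L < S j z] `&` [set z | L < X j z]) `&` [set z | s < S j z + X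
  j z].
    by apply/seteqP; split => z; [case|case=> -[]].
  by apply: measurableI; [apply: measurableI|]; apply: measurable_ltset => //; exact:
    measurable_funD.
- have -> : E = ([set u | L - 1 < X j u.1] `&` [set u | L - 1 < X j u.2]) `&` [set u | s
  - 1 < X j u.1 + X j u.2].
    by apply/seteqP; split => z; [case|case=> -[]].
  by apply: measurableI; [apply: measurableI|]; apply: measurable_ltset => //; exact:
    measurable_funD.
- apply/trivIsetP => m n _ _ mn; apply/seteqP; split=> // u [[_ +] [_ +]].
  rewrite /I /= !in_itv/= => /andP[m1 m2] /andP[n1 n2].
  have : (m%:R < n.+1%:R :> R) by rewrite -natr1; lra.
  have : (n%:R < m.+1%:R :> R) by rewrite -natr1; lra.
  rewrite !ltr_nat !ltnS => nm mn'; move/eqP: mn; apply; apply/eqP.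
  by rewrite eqn_leq nm mn'.
- move=> n; set x := Num.max L (s - L - n%:R - 1).
  have xL : L <= x by rewrite le_max lexx.
  have mIn : measurable (I n) by exact: measurable_itv.
  have mgt : measurable `]x, +oo[%classic by [].
  have -> : prob (square_measure P) (B n) = tail F x * prob P [set z | I n (X j z)].
    have := square_prob (X j) mgt mIn.
    rewrite [X in X * _](_ : _ = tail F x); last first.
      rewrite -(prob_gt_tail (cdfX (i := j) _)) ?j1//; congr prob.
      by apply/seteqP; split => z /=; rewrite in_itv/= andbT.
    move=> <-; congr prob; apply/seteqP; split => u /=; rewrite in_itv/= andbT//.
  apply: le_trans (quasi_indep _ _ mIn _) _; rewrite ?j2//.
  + exact: lt_le_trans ltr01 (le_trans L1 xL).
  + by move=> y; rewrite /I/= !in_itv/= andbT => /andP[+ _]; apply: le_trans; rewrite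
    (le_trans Lt0)// lerDl.
  rewrite mulrA ler_wpM2r ?prob_ge0// -mulrA ler_wpM2l ?(ltW M0)//.
  by apply: SC; rewrite (le_trans Ls1).
- move=> z [/= LS LX sSX].
  exists (Num.Def.truncn (X j z - L)) => //.
  have /andP[] := @truncn_itv _ (X j z - L) ltac:(rewrite subr_ge0; exact: ltW).
  rewrite -natr1; set n := Num.Def.truncn _ => n1 n2.
  by rewrite /A/I/= in_itv/= gt_max; split; [apply/andP; split|apply/andP; split]; lra.
- move=> u [n _]; rewrite /B/I/E/= in_itv/= gt_max => -[/andP[a1 a2] /andP[b1 b2]].
  have n0 : 0 <= n%:R :> R by [].
  by split; lra.
Qed.

Definition pos_wsum (c : nat -> R) j z := \sum_(1 <= i < j) c i * Num.max (X i z) 0.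

Lemma measurable_pos_wsum c j : measurable_fun setT (pos_wsum c j).
Proof.
by apply: measurable_sum => i; apply: measurable_funM => //; exact: measurable_maxr.
Qed.

(** Induction on the number of terms.  If the sum exceeds [t], then either the
    partial sum or the last term exceeds [t - h], or both exceed the constant
    [h].  As the weights are at least [eta], a shift of [t] by [h] shifts
    [t / c i] by at most [h / eta], uniformly.  In the last case all terms may be
    given the largest weight, and [sum_both_large] applies. *)
Lemma pos_wsum_upper k (eta b e : R) : (k <= N)%N -> 0 < eta -> 0 < b -> 0 < e ->
  exists t1, forall t, t1 <= t ->
  forall c, (forall i, (1 <= i < k.+1)%N -> eta <= c i <= b) ->
  prob P [set z | t < pos_wsum c k.+1 z] <=
  (1 + e) * \sum_(1 <= i < k.+1) tail F (t / c i).
Proof.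
elim: k eta b e => [|k IH] eta b e kN eta0 b0 e0.
  exists 0 => t tt c _; rewrite [X in prob _ X](_ : _ = set0).
    by rewrite /prob measure0 big_geq// mulr0.
  by apply/seteqP; split => // z /=; rewrite /pos_wsum big_geq//; lra.
have k1N : (1 <= k.+1 <= N)%N by [].
have ndF := cdf_homo (cdfX (i := k.+1) k1N).
have [s1 S1] := IH 1 1 1 (ltnW kN) ltr01 ltr01 ltr01.
pose C : R := 2 * k%:R.
have C0 : 0 <= C by rewrite mulr_ge0.
have SC s : s1 <= s -> prob P [set z | s < S k.+1 z] <= C * tail F s.
  move=> ss1; have := S1 s ss1 (fun=> 1) (fun i _ => ltac:(by rewrite lexx)).
  under eq_bigr do rewrite divr1.
  rewrite [X in prob _ X](_ : _ = [set z | s < S k.+1 z]); last first.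
    have wS z : pos_wsum (fun=> 1) k.+1 z = S k.+1 z.
      by apply: eq_bigr => i _; rewrite mul1r.
    by apply/seteqP; split => z /=; rewrite wS.
  by rewrite big_const_nat iter_addr_0 subn1/= -mulr_natl mulrA.
pose e' := Num.min (e / 4) 1.
have e'0 : 0 < e' by rewrite lt_min; apply/andP; split; lra.
have e'1 : e' <= 1 by rewrite ge_min lexx orbT.
have e'e : 4 * e' <= e by have : e' <= e / 4; [rewrite ge_min lexx|lra].
clearbody e'.
have [L0 [s0 both]] := sum_both_large k1N C0 SC e'0.
(* With weights at most [b], this makes [h / c i] at least [L0]. *)
pose h := b * `|L0|.
have h0 : 0 <= h by rewrite mulr_ge0// ltW.
have [t1 H1] := IH eta b e' (ltnW kN) eta0 b0 e'0.
have [t2 H2] := @long_tailed_shift _ F ndF long (h / eta) e' e'0.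
exists (Num.max (t1 + h) (Num.max (b * `|t2|) (Num.max (b * `|s0|) 0))) => t.
rewrite !ge_max => /and4P[tt1 tt2 ts0 t_0] c cb.
have cpos i : (1 <= i < k.+2)%N -> 0 < c i.
  by move=> /cb/andP[+ _]; exact: lt_le_trans.
have big_arg x i : (1 <= i < k.+2)%N -> b * `|x| <= t -> x <= t / c i.
  move=> ik xt; have ci := cpos _ ik; have /andP[_ cib] := cb _ ik.
  rewrite ler_pdivlMr// (le_trans _ xt)// mulrC.
  apply: (@le_trans _ _ (c i * `|x|)); first by rewrite ler_wpM2l ?ler_norm// ltW.
  by rewrite ler_wpM2r.
have shift i : (1 <= i < k.+2)%N -> tail F ((t - h) / c i) <= (1 + e') * tail F (t / c i).
  move=> ik; apply: le_trans (H2 _ (big_arg _ _ ik tt2)).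
  apply: (le_tail ndF); rewrite mulrBl lerD2l lerN2 ler_wpM2l//.
  by rewrite lef_pV2 ?posrE ?cpos//; have /andP[] := cb _ ik.
have [i0 i0k cmax] := exists_argmax c k.
have c0 := cpos _ i0k.
pose A1 := [set z | t - h < pos_wsum c k.+1 z].
pose A2 := [set z | (t - h) / c k.+1 < X k.+1 z].
pose A3 := [set z | [/\ h / c i0 < S k.+1 z, h / c i0 < X k.+1 z & t / c i0 < S k.+1 z +
  X k.+1 z]].
have mA1 : measurable A1 by apply: measurable_ltset => //; exact: measurable_pos_wsum.
have mA2 : measurable A2 by exact: measurable_ltset.
have mS := measurable_pos_sum k.+1.
have mA3 : measurable A3.
  have -> : A3 = ([set z | h / c i0 < S k.+1 z] `&` [set z | h / c i0 < X k.+1 z]) `&`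
    [set z | t / c i0 < S k.+1 z + X k.+1 z].
    by apply/seteqP; split => z; [case|case=> -[]].
  by apply: measurableI; [apply: measurableI|]; apply: measurable_ltset => //; exact:
    measurable_funD.
have Sle z : pos_wsum c k.+1 z <= c i0 * S k.+1 z.
  rewrite /pos_wsum /pos_sum mulr_sumr !big_nat; apply: ler_sum => i /andP[i1 ik].
  by rewrite ler_wpM2r ?le_max ?lexx ?orbT// cmax// i1 ltnW.
have sub : [set z | t < pos_wsum c k.+2 z] `<=` (A1 `|` A2) `|` A3.
  move=> z /=; rewrite {1}/pos_wsum big_nat_recr//= -/(pos_wsum c k.+1 z).
  have ck := cpos k.+1 ltac:(by rewrite ltnS leqnn).
  have [zA1|zA1] := ltP (t - h) (pos_wsum c k.+1 z); first by left; left.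
  have [zA2|zA2] := ltP ((t - h) / c k.+1) (X k.+1 z); first by left; right.
  have X1 : c k.+1 * X k.+1 z <= t - h by rewrite mulrC -ler_pdivlMr.
  have S0 : 0 <= S k.+1 z by apply: sumr_ge0 => i _; rewrite le_max lexx orbT.
  have [X0|X0] := leP (X k.+1 z) 0; first by lra.
  move=> tX; right; have Sz := Sle z.
  have cX : c k.+1 * X k.+1 z <= c i0 * X k.+1 z.
    by rewrite ler_wpM2r ?(ltW X0)// cmax// ltnS leqnn.
  by rewrite /A3/=; split; rewrite ltr_pdivrMr// mulrC ?mulrDr; lra.
have PA1 : prob P A1 <= (1 + e') * \sum_(1 <= i < k.+1) ((1 + e') * tail F (t / c i)).
  apply: le_trans (H1 (t - h) _ c _) _.
  - by rewrite lerBrDr.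
  - by move=> i /andP[i1 ik]; apply: cb; rewrite i1 ltnW.
  rewrite ler_wpM2l//; first by lra.
  rewrite !big_nat; apply: ler_sum => i /andP[i1 ik].
  by apply: shift; rewrite i1 ltnW.
have PA2 : prob P A2 <= (1 + e') * tail F (t / c k.+1).
  by rewrite (prob_gt_tail (cdfX (i := k.+1) k1N)); apply: shift; rewrite ltnS leqnn.
have PA3 : prob P A3 <= e' * tail F (t / c i0).
  apply: both; last exact: big_arg.
  rewrite ler_pdivlMr// mulrC /h; have /andP[_ cib] := cb _ i0k.
  apply: (@le_trans _ _ (c i0 * `|L0|)); first by rewrite ler_wpM2l ?ler_norm// ltW.
  by rewrite ler_wpM2r.
have P123 : prob P [set z | t < pos_wsum c k.+2 z] <= prob P A1 + prob P A2 + prob P A3.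
  have mA12 : measurable (A1 `|` A2) by exact: measurableU.
  apply: le_trans (le_trans (probU P mA12 mA3) _); last by rewrite lerD2r probU.
  apply: le_prob => //; last exact: measurableU.
  by apply: measurable_ltset => //; exact: measurable_pos_wsum.
have tsum : tail F (t / c i0) <= \sum_(1 <= i < k.+2) tail F (t / c i).
  rewrite (bigD1_seq i0) ?mem_index_iota ?iota_uniq//= lerDl.
  by apply: sumr_ge0 => i _; exact: ltW (tail_gt0 long _).
apply: (le_trans P123).
have split_last : \sum_(1 <= i < k.+2) tail F (t / c i) =
    \sum_(1 <= i < k.+1) tail F (t / c i) + tail F (t / c k.+1).
  by rewrite big_nat_recr.
move: PA1 PA2 PA3 tsum; rewrite -mulr_sumr split_last.
have : 0 <= \sum_(1 <= i < k.+1) tail F (t / c i).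
  by apply: sumr_ge0 => i _; exact: ltW (tail_gt0 long _).
have := tail_gt0 long (t / c k.+1); have := tail_gt0 long (t / c i0).
move: (tail F (t / c i0)) (tail F (t / c k.+1)) (\sum_(1 <= i < k.+1) _).
move: (prob P A1) (prob P A2) (prob P A3) => p1 p2 p3 x y u x0 y0 u0 h1 h2 h3 h4.
have : e' * x <= e' * (u + y) by rewrite ler_wpM2l// ltW.
move=> h5.
have h6 : e' * e' <= e' by rewrite ler_piMr// ltW.
clear -e'0 e'1 e'e y0 u0 h1 h2 h3 h5 h6 e0; nra.
Qed.

End upper_bound.

(** * Random weights *)

Section core.
Context (R : realType) d (T : measurableType d) (P : probability T R).
Context d1 (T1 : measurableType d1) d2 (T2 : measurableType d2).
Variables (f1 : {mfun T >-> T1}) (f2 : {mfun T >-> T2}).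
Hypothesis f12 : forall A B, measurable A -> measurable B ->
  P (f1 @^-1` A `&` f2 @^-1` B) = (P (f1 @^-1` A) * P (f2 @^-1` B))%E.
(* The weights are functions of [f1] and the variables [X i] are functions of
   [f2], so that either of them can be frozen. *)
Variables (N : nat) (theta : nat -> T1 -> R) (Y : nat -> T2 -> R).
Variables (X : nat -> {RV P >-> R}) (F : R -> R) (b t0 M : R).
Hypothesis N0 : (0 < N)%N.
Hypothesis mtheta : forall i, measurable_fun setT (theta i).
Hypothesis mY : forall i, measurable_fun setT (Y i).
Hypothesis XY : forall i z, (1 <= i <= N)%N -> X i z = Y i (f2 z).
Hypothesis theta_gt0 : forall i c, 0 < theta i c.
Hypothesis theta_le : forall i c, theta i c <= b.
Hypothesis b0 : 0 < b.
Hypothesis cdfX : forall i, (1 <= i <= N)%N -> forall x, cdf (X i) x = (F x)%:E.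
Hypothesis Fsub : subexponential F.
Hypothesis M0 : 0 < M.
Local Notation S := (pos_sum (fun i => X i)).
Hypothesis quasi_indep : forall j, (2 <= j <= N)%N -> forall s (B : set R), 0 < s ->
  measurable B -> B `<=` `[t0, +oo[%classic ->
  prob P [set z | s < S j z /\ B (X j z)] <=
  M * prob P [set z | s < S j z] * prob P [set z | B (X j z)].
Hypothesis Fleft : left_tail_negligible F.

Let long : long_tailed F. Proof. by case: Fsub. Qed.
Let ndF : {homo F : x y / x <= y}.
Proof. by apply: (cdf_homo (cdfX (i := N) _)); rewrite N0 leqnn. Qed.

Definition wX i z := theta i (f1 z) * X i z.
Definition sum_of_tails t := \sum_(1 <= i < N.+1) prob P [set z | t < wX i z].

Let mf1 : measurable_fun setT f1. Proof. exact: measurable_funPT. Qed.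
Let mf2 : measurable_fun setT f2. Proof. exact: measurable_funPT. Qed.

Let mthetaT i : measurable_fun setT (theta i \o f1).
Proof. exact: measurableT_comp. Qed.

Let mtheta1 i : measurable_fun setT (fun p : T1 * T2 => theta i p.1).
Proof. exact: (measurableT_comp (mtheta i)). Qed.

Let mY2 i : measurable_fun setT (fun p : T1 * T2 => Y i p.2).
Proof. exact: (measurableT_comp (mY i)). Qed.

Lemma measurable_wX i : measurable_fun setT (wX i).
Proof. by apply: measurable_funM => //; exact: mthetaT. Qed.

Let mgt t i : measurable [set z | t < wX i z].
Proof. by apply: measurable_ltset => //; exact: measurable_wX. Qed.

Lemma prob_scaled_gt i c t : (1 <= i <= N)%N -> 0 < c ->
  prob P [set z | t < c * Y i (f2 z)] = tail F (t / c).
Proof.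
move=> iN c0; rewrite -(prob_gt_tail (cdfX iN)); congr prob.
by apply/seteqP; split => z /=; rewrite ltr_pdivrMr// mulrC XY.
Qed.

(** Reduction to a constant weight [c], for events controlled by one term. *)
Lemma indep_wX_le i (A : set (T1 * T2)) a t : (1 <= i <= N)%N ->
  measurable A -> 0 <= a ->
  (forall c, prob P [set z | A (c, f2 z)] <= a * tail F (t / theta i c)) ->
  prob P [set z | A (f1 z, f2 z)] <= a * prob P [set z | t < wX i z].
Proof.
move=> iN mA a0 H.
have := @indep_prob_le _ _ _ P _ _ _ _ f1 f2 f12 A 2%N
  (fun=> [set p | t < theta i p.1 * Y i p.2]) a mA _ a0.
rewrite big_nat1 (_ : prob P [set z | t < wX i z] =
   prob P [set z | t < theta i (f1 z) * Y i (f2 z)]).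
  apply.
    by move=> j _; apply: measurable_ltset => //; apply: measurable_funM;
      [exact: mtheta1|exact: mY2].
  by move=> c; rewrite big_nat1/= prob_scaled_gt// theta_gt0.
by congr prob; apply/seteqP; split => z /=; rewrite /wX XY.
Qed.

(** As the weight is positive, the probability that it is at most [eta] tends to
    0 with [eta]. *)
Lemma small_weight i (e : R) : (1 <= i <= N)%N -> 0 < e ->
  exists2 eta0, 0 < eta0 & forall eta, 0 < eta <= eta0 ->
    prob P [set z | theta i (f1 z) <= eta] <= e * prob P [set z | eta < theta i (f1 z)].
Proof.
move=> iN e0.
pose A n := [set z | theta i (f1 z) <= n.+1%:R^-1].
have mle x : measurable [set z | theta i (f1 z) <= x].
  by apply: measurable_leset => //; exact: mthetaT.
have mlt x : measurable [set z | x < theta i (f1 z)].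
  by apply: measurable_ltset => //; exact: mthetaT.
have A0 : \bigcap_n A n = set0.
  apply/seteqP; split => // z Az; have z0 := theta_gt0 i (f1 z).
  have := Az (Num.Def.truncn (theta i (f1 z))^-1) I; rewrite /A/=.
  rewrite leNgt => /negP; apply; rewrite invf_plt ?posrE//.
  exact: truncnS_gt.
have : P (A n) @[n --> \oo] --> P (\bigcap_n A n).
  apply: nonincreasing_cvg_mu => //.
  - by rewrite ltey_eq fin_num_measure//; exact: mle.
  - by move=> n; exact: mle.
  - by rewrite A0.
  - move=> m n mn; apply/subsetPset => z; rewrite /A/= => /le_trans; apply.
    by rewrite lef_pV2 ?posrE// ler_nat ltnS.
rewrite A0 measure0 => /fine_cvgP[_] /cvgrPdist_le.
pose k := e / (1 + e).
have k0 : 0 < k by rewrite divr_gt0//; lra.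
move=> /(_ k k0)[n _ /(_ n (leqnn n))] /=; rewrite sub0r normrN => /(le_trans (ler_norm
  _)) Ak.
exists n.+1%:R^-1 => // eta /andP[eta0 etan].
have small : prob P [set z | theta i (f1 z) <= eta] <= k.
  by apply: le_trans Ak; apply: le_prob; [exact: mle|exact: mle|move=> z /= /le_trans;
    exact].
have := prob_split P measurableT (mle eta); rewrite [LHS]/prob probability_setT/= setTI.
rewrite (_ : setT `\` _ = [set z | eta < theta i (f1 z)]); last first.
  by apply/seteqP; split => z /=; rewrite ltNge; [case=> _ /negP|move=> /negP].
move=> tot; have : k * (1 + e) = e by rewrite /k; field; rewrite gt_eqF//; lra.
move: small tot; clearbody k; move: (prob P _) (prob P _) => x y; nra.
Qed.

Lemma small_weights (e : R) : 0 < e ->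
  exists2 eta, 0 < eta & forall i, (1 <= i <= N)%N ->
    prob P [set z | theta i (f1 z) <= eta] <= e * prob P [set z | eta < theta i (f1 z)].
Proof.
move=> e0.
suff [eta eta0 H] : exists2 eta0, 0 < eta0 & forall i, (1 <= i <= N)%N -> forall eta, 0 <
  eta <= eta0 ->
    prob P [set z | theta i (f1 z) <= eta] <= e * prob P [set z | eta < theta i (f1 z)].
  by exists eta => // i iN; apply: H => //; rewrite eta0 lexx.
have : (N <= N)%N by [].
elim: {1 3}N => [|n IH] nN; first by exists 1 => // -[|i].
have [x x0 Hx] := IH (ltnW nN).
have [//|y y0 Hy] := @small_weight n.+1 e _ e0.
exists (Num.min x y); first by rewrite lt_min x0.
move=> i /andP[i1]; rewrite leq_eqVlt => /orP[/eqP->|iN] eta; rewrite le_min => /and3P[h1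
  h2 h3].
  by apply: Hy; rewrite h1.
by apply: Hx; rewrite ?i1 ?h1.
Qed.

Section small_part.
Variables (i : nat) (e eta : R).
Hypothesis iN : (1 <= i <= N)%N.
Hypothesis e0 : 0 < e.
Hypothesis eta0 : 0 < eta.
Hypothesis small :
    prob P [set z | theta i (f1 z) <= eta] <= e * prob P [set z | eta < theta i (f1 z)].

Let indep_prod (A B : set R) : measurable A -> measurable B ->
  prob P [set z | A (theta i (f1 z)) /\ B (X i z)] =
  prob P [set z | A (theta i (f1 z))] * prob P [set z | B (X i z)].
Proof.
move=> mA mB.
have mA1 : measurable (theta i @^-1` A) by rewrite -[_ @^-1` _]setTI; exact: mtheta.
have mB1 : measurable (Y i @^-1` B) by rewrite -[_ @^-1` _]setTI; exact: mY.
have E1 : measurable (f1 @^-1` (theta i @^-1` A)) by rewrite -[_ @^-1` _]setTI; exact: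
  mf1.
have E2 : measurable (f2 @^-1` (Y i @^-1` B)) by rewrite -[_ @^-1` _]setTI; exact: mf2.
have -> : [set z | B (X i z)] = f2 @^-1` (Y i @^-1` B).
  by apply/seteqP; split => z /=; rewrite XY.
have -> : [set z | A (theta i (f1 z)) /\ B (X i z)] =
    f1 @^-1` (theta i @^-1` A) `&` f2 @^-1` (Y i @^-1` B).
  by apply/seteqP; split => z /=; rewrite XY.
apply: EFin_inj; rewrite EFinM -!probE//; first exact: f12.
exact: measurableI.
Qed.

Let split_le x y :
  prob P [set z | theta i (f1 z) <= x /\ y < X i z] =
  prob P [set z | theta i (f1 z) <= x] * tail F y.
Proof.
rewrite -(prob_gt_tail (cdfX iN)).
have := indep_prod (measurable_itv `]-oo, x]) (measurable_itv `]y, +oo[).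
congr (prob P _ = prob P _ * prob P _);
by apply/seteqP; split => z /=; rewrite !in_itv/= ?andbT.
Qed.

Let split_gt x y :
  prob P [set z | x < theta i (f1 z) /\ y < X i z] =
  prob P [set z | x < theta i (f1 z)] * tail F y.
Proof.
rewrite -(prob_gt_tail (cdfX iN)).
have := indep_prod (measurable_itv `]x, +oo[) (measurable_itv `]y, +oo[).
congr (prob P _ = prob P _ * prob P _);
by apply/seteqP; split => z /=; rewrite !in_itv/= ?andbT.
Qed.

Lemma big_weight_le t : 0 <= t ->
  prob P [set z | eta < theta i (f1 z)] * tail F (t / eta) <=
  prob P [set z | t < wX i z].
Proof.
move=> t_0; rewrite -split_gt; apply: le_prob; last 1 first.
- move=> z /= [etaz]; rewrite ltr_pdivrMr// /wX mulrC => tX.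
  have X0 : 0 < X i z.
    rewrite ltNge; apply/negP => X0; have : eta * X i z <= 0 by rewrite pmulr_rle0.
    by rewrite leNgt (le_lt_trans t_0).
  by rewrite (lt_trans tX)// ltr_pM2r.
- apply: measurable_andset; apply: measurable_ltset => //; exact: mthetaT.
- exact: mgt.
Qed.

(** On a small weight, exceeding [t] forces [X i] above [t / eta].  By
    independence this has the fraction [P(theta i <= eta)] of the probability of
    [t / eta < X i], while the fraction [P(eta < theta i)] of it belongs to
    [t < wX i]. *)
Lemma small_part_le t : 0 <= t ->
  prob P [set z | theta i (f1 z) <= eta /\ t / eta < X i z] <=
  e * prob P [set z | t < wX i z].
Proof.
move=> t_0; rewrite split_le.
apply: (le_trans _ (ler_wpM2l (ltW e0) (big_weight_le t_0))).
by rewrite mulrA ler_wpM2r// ltW// tail_gt0.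
Qed.

Lemma wX_gt_small t : 0 <= t ->
  prob P [set z | t < wX i z] <= prob P [set z | eta < theta i (f1 z) /\ t < wX i z]
     + e * prob P [set z | t < wX i z].
Proof.
move=> t_0; apply: le_trans (lerD (lexx _) (small_part_le t_0)).
have m1 : measurable [set z | eta < theta i (f1 z) /\ t < wX i z].
  by apply: measurable_andset; [apply: measurable_ltset => //; exact: mthetaT|exact: mgt].
have m2 : measurable [set z | theta i (f1 z) <= eta /\ t / eta < X i z].
  by apply: measurable_andset; [apply: measurable_leset => //; exact: mthetaT|exact:
    measurable_ltset].
apply: le_trans (probU P m1 m2); apply: le_prob; [exact: mgt|exact: measurableU|].
move=> z /= tX; have [h|h] := ltP eta (theta i (f1 z)); [by left|right; split=> //].
have th0 := theta_gt0 i (f1 z).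
have X0 : 0 < X i z by rewrite -(pmulr_rgt0 _ th0) (le_lt_trans t_0).
by rewrite ltr_pdivrMr// mulrC (lt_le_trans tX)// ler_wpM2r// ltW.
Qed.

Lemma wX_gt_gt0 t : 0 <= t -> 0 < prob P [set z | t < wX i z].
Proof.
move=> t_0; apply: lt_le_trans (big_weight_le t_0).
have m1 : measurable [set z | theta i (f1 z) <= eta].
  by apply: measurable_leset => //; exact: mthetaT.
rewrite mulr_gt0 ?tail_gt0// lt_neqAle prob_ge0 andbT; apply/eqP => p0.
have := prob_split P measurableT m1; rewrite [LHS]/prob probability_setT/= setTI.
rewrite (_ : setT `\` _ = [set z | eta < theta i (f1 z)]); last first.
  by apply/seteqP; split => z /=; rewrite ltNge; [case=> _ /negP|move=> /negP].
by move: small; rewrite -p0; lra.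
Qed.

(** Raising the weight to at least [eta] only adds the event of
    [small_part_le]. *)
Lemma lifted_weight_le t : 0 <= t ->
  prob P [set z | t < Num.max (theta i (f1 z)) eta * X i z] <=
  (1 + e) * prob P [set z | t < wX i z].
Proof.
move=> t_0; rewrite mulrDl mul1r.
apply: le_trans (lerD (lexx _) (small_part_le t_0)).
have m2 : measurable [set z | theta i (f1 z) <= eta /\ t / eta < X i z].
  by apply: measurable_andset; [apply: measurable_leset => //; exact: mthetaT|exact:
    measurable_ltset].
apply: le_trans (probU P (mgt t i) m2); apply: le_prob.
- apply: measurable_ltset => //; apply: measurable_funM => //.
  by apply: measurable_maxr => //; exact: mthetaT.
- by apply: measurableU => //; exact: mgt.
move=> z /=; have [h|h] := leP (theta i (f1 z)) eta; last by left.
by move=> tX; right; split=> //; rewrite ltr_pdivrMr// mulrC.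
Qed.

End small_part.

Lemma sum_of_tails_gt0 t : 0 <= t -> 0 < sum_of_tails t.
Proof.
move=> t_0; have [eta eta0 small] := small_weights ltr01.
rewrite /sum_of_tails big_nat_recr//= addrC ltr_wpDr ?sumr_ge0// => [i _|]; first exact:
  prob_ge0.
have NN : (1 <= N <= N)%N by rewrite N0 leqnn.
exact: (wX_gt_gt0 NN eta0 (small N NN)).
Qed.

(** Raising all weights to at least [eta] increases the sum of the positive
    parts and brings the weights into an interval where the uniform bound
    holds. *)
Lemma sum_upper (e : R) : 0 < e -> exists t1, forall t, t1 <= t ->
  prob P [set z | t < \sum_(1 <= i < N.+1) wX i z] <= (1 + e) * sum_of_tails t.
Proof.
move=> e0; pose k := Num.min (e / 3) 1.
have k0 : 0 < k by rewrite lt_min; apply/andP; split; lra.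
have k1 : k <= 1 by rewrite ge_min lexx orbT.
have ke : 3 * k <= e by have : k <= e / 3; [rewrite ge_min lexx|lra].
clearbody k.
have [eta eta0 small] := small_weights k0.
have b1 : 0 < Num.max b eta by rewrite lt_max b0.
have [t1 H1] := pos_wsum_upper cdfX Fsub M0 quasi_indep (leqnn N) eta0 b1 k0.
exists (Num.max t1 0) => t; rewrite ge_max => /andP[tt1 t_0].
pose A := [set p : T1 * T2 | t <
  \sum_(1 <= i < N.+1) Num.max (theta i p.1) eta * Num.max (Y i p.2) 0].
pose B i := [set p : T1 * T2 | t < Num.max (theta i p.1) eta * Y i p.2].
have mA : measurable A.
  apply: measurable_ltset => //; apply: measurable_sum => i.
  by apply: measurable_funM; apply: measurable_maxr.
have mB i : (1 <= i < N.+1)%N -> measurable (B i).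
  move=> iN; apply: measurable_ltset => //; apply: measurable_funM => //.
  exact: measurable_maxr.
have max0 c i : 0 < Num.max (theta i c) eta by rewrite lt_max eta0 orbT.
have Aw c z : A (c, f2 z) = (t < pos_wsum X (fun i => Num.max (theta i c) eta) N.+1 z).
  congr (is_true (_ < _)); apply: eq_big_nat => i iN; by rewrite XY.
have := @indep_prob_le _ _ _ P _ _ _ _ f1 f2 f12 A N.+1 B (1 + k) mA mB.
have -> : prob P [set z | A (f1 z, f2 z)] =
   prob P [set z | t < pos_wsum X (fun i => Num.max (theta i (f1 z)) eta) N.+1 z].
  by congr prob; apply/seteqP; split => z /=; rewrite Aw.
move=> H; apply: (@le_trans _ _ (prob P [set z | t < pos_wsum X (fun i => Num.max (theta
  i (f1 z)) eta) N.+1 z])).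
  apply: le_prob.
  - by apply: measurable_ltset => //; apply: measurable_sum; exact: measurable_wX.
  - apply: measurable_ltset => //; apply: measurable_sum => i.
    by apply: measurable_funM; apply: measurable_maxr => //; exact: mthetaT.
  move=> z /= /lt_le_trans; apply; rewrite /pos_wsum !big_nat; apply: ler_sum => i iN.
  have th0 := theta_gt0 i (f1 z).
  rewrite /wX (@le_trans _ _ (theta i (f1 z) * Num.max (X i z) 0))//.
    by rewrite ler_pM2l// le_max lexx.
  by rewrite ler_wpM2r// le_max lexx ?orbT.
apply: le_trans (H _ _) _; first lra.
  move=> c; have -> : prob P [set z | A (c, f2 z)] =
     prob P [set z | t < pos_wsum X (fun i => Num.max (theta i c) eta) N.+1 z].
    by congr prob; apply/seteqP; split => z /=; rewrite Aw.
  rewrite (_ : \sum_(1 <= i < N.+1) _ = \sum_(1 <= i < N.+1) tail F (t / Num.max (theta i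
    c) eta)).
    apply: H1 => // i iN; rewrite le_max lexx orbT/= ge_max !le_max lexx orbT andbT.
    by rewrite theta_le.
  by apply: eq_big_nat => i iN; rewrite /B/= prob_scaled_gt.
rewrite /sum_of_tails; apply: (@le_trans _ _ ((1 + k) * \sum_(1 <= i < N.+1) (1 + k) *
  prob P [set z | t < wX i z])).
  rewrite ler_wpM2l//; first lra.
  rewrite !big_nat; apply: ler_sum => i iN.
  have := lifted_weight_le iN k0 eta0 (small i iN) t_0; congr (_ <= _).
  by congr prob; apply/seteqP; split => z /=; rewrite XY.
rewrite -mulr_sumr mulrA ler_wpM2r//; last by nra.
by apply: sumr_ge0 => i _; exact: prob_ge0.
Qed.

Definition some_gt t k := [set z | exists2 i, (1 <= i <= k)%N & t < wX i z].

Let some_gtS t k : some_gt t k.+1 = some_gt t k `|` [set z | t < wX k.+1 z].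
Proof.
apply/seteqP; split => z /=.
  move=> [i /andP[i1]]; rewrite leq_eqVlt => /orP[/eqP->|ik] tX; first by right.
  by left; exists i => //; rewrite i1.
move=> [[i /andP[i1 ik] tX]|tX]; first by exists i => //; rewrite i1 ltnW.
by exists k.+1 => //; rewrite leqnn.
Qed.

Let measurable_some_gt t k : measurable (some_gt t k).
Proof. by apply: measurable_exset => i; exact: mgt. Qed.

(** An earlier large term makes the unweighted partial sum large, as weights are
    at most [b]; the dependence bound is about this partial sum. *)
Lemma some_gt_pos_sum t j z : 0 < t -> (j < N)%N -> some_gt t j z -> t / b < S j.+1 z.
Proof.
move=> t_0 jN [i /andP[i1 ij] tX].
have th0 := theta_gt0 i (f1 z).
have X0 : 0 < X i z by rewrite -(pmulr_rgt0 _ th0) (lt_trans t_0).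
have tb : t / b < X i z.
  rewrite ltr_pdivrMr// mulrC (lt_le_trans tX)// ler_wpM2r ?theta_le// ltW//.
apply: (lt_le_trans tb).
rewrite /pos_sum (bigD1_seq i) ?mem_index_iota ?iota_uniq ?i1 ?ltnS//=.
apply: (@le_trans _ _ (Num.max (X i z) 0)); first by rewrite le_max lexx.
by rewrite lerDl sumr_ge0// => k _; rewrite le_max lexx orbT.
Qed.

(** Freeze the weight of the term [j]: given that it exceeds [t], the partial
    sum of the earlier variables exceeds [t / b] with probability at most
    [M * P(t / b < S j)], which tends to 0. *)
Lemma overlap_le e : 0 < e -> exists t1, forall t, t1 <= t ->
  forall j, (1 <= j <= N)%N ->
  prob P ([set z | t < wX j z] `&` some_gt t j.-1) <= e * prob P [set z | t < wX j z].
Proof.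
move=> e0.
suff [t1 H1] : exists t1, forall j, (1 <= j <= N)%N -> forall t, t1 <= t ->
    prob P ([set z | t < wX j z] `&` some_gt t j.-1) <= e * prob P [set z | t < wX j z].
  by exists t1 => t tt j jN; exact: H1.
have : (N <= N)%N by [].
elim: {1 3}N => [|n IH] nN; first by exists 0 => -[|i].
have [t1 H1] := IH (ltnW nN).
suff [t2 H2] : exists t2, forall t, t2 <= t ->
    prob P ([set z | t < wX n.+1 z] `&` some_gt t n) <= e * prob P [set z | t < wX n.+1
      z].
  exists (Num.max t1 t2) => j /andP[j1]; rewrite leq_eqVlt => /orP[/eqP->|jn] t;
    rewrite ge_max => /andP[tt1 tt2]; first exact: H2.
  by apply: H1; rewrite ?j1.
have [n0|n0] := posnP n.
  exists 0 => t _; rewrite [X in prob _ X](_ : _ = set0).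
    by rewrite /prob measure0 mulr_ge0 ?prob_ge0// ltW.
  by apply/seteqP; split => // z [_ [i /andP[i1]]]; rewrite n0 leqNgt i1.
have nN' : (1 <= n.+1 <= N)%N by [].
have nN2 : (2 <= n.+1 <= N)%N by rewrite ltnS n0.
have mS : measurable_fun setT (S n.+1) by apply: measurable_sum => i; exact:
  measurable_maxr.
have [t2 H2] := prob_gt_vanish P mS (divr_gt0 e0 M0).
exists (Num.max (b * `|t2|) (Num.max (b * `|t0|) 1)) => t; rewrite !ge_max => /and3P[tt2
  tt0 t1'].
have t_0 : 0 < t by exact: lt_le_trans t1'.
have tb0 : 0 < t / b by rewrite divr_gt0.
pose A := [set p : T1 * T2 | t < theta n.+1 p.1 * Y n.+1 p.2 /\
   t / b < \sum_(1 <= i < n.+1) Num.max (Y i p.2) 0].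
have mA : measurable A.
  apply: measurable_andset; apply: measurable_ltset => //; first exact: measurable_funM.
  by apply: measurable_sum => i; exact: measurable_maxr.
have SY z : S n.+1 z = \sum_(1 <= i < n.+1) Num.max (Y i (f2 z)) 0.
  by apply: eq_big_nat => i /andP[i1 ij]; rewrite XY// i1/= (leq_trans (ltnW ij)).
apply: (@le_trans _ _ (prob P [set z | A (f1 z, f2 z)])).
  apply: le_prob.
  - exact: measurableI.
  - rewrite (_ : [set z | _] = [set z | t < wX n.+1 z /\ t / b < S n.+1 z]).
      by apply: measurable_andset; [exact: mgt|exact: measurable_ltset].
    by apply/seteqP; split => z; rewrite /A/= /wX XY// SY.
  move=> z [/= tX sX]; rewrite /A/= -SY -XY//; split => //.
  exact: some_gt_pos_sum.
apply: indep_wX_le => //; first exact: ltW.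
move=> c; rewrite [X in prob _ X](_ : _ = [set z | t / b < S n.+1 z /\
    `]t / theta n.+1 c, +oo[%classic (X n.+1 z)]); last first.
  apply/seteqP; split => z; rewrite /A/= SY in_itv/= andbT XY//;
    (have -> : (t / theta n.+1 c < Y n.+1 (f2 z)) = (t < theta n.+1 c * Y n.+1 (f2 z));
      first by rewrite ltr_pdivrMr ?theta_gt0// mulrC);
    by move=> -[? ?]; split.
have tbc : t / b <= t / theta n.+1 c.
  by rewrite ler_wpM2l ?(ltW t_0)// lef_pV2 ?posrE ?theta_gt0// theta_le.
have big x : b * `|x| <= t -> x <= t / b.
  by move=> h; rewrite ler_pdivlMr// (le_trans _ h)// mulrC ler_wpM2l ?ler_norm// ltW.
apply: le_trans (quasi_indep nN2 (B := `]t / theta n.+1 c, +oo[%classic) tb0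
  (measurable_itv _) _) _.
  by move=> y /=; rewrite !in_itv/= !andbT => /ltW; apply: le_trans; rewrite (le_trans _
    tbc)// big.
rewrite (_ : [set z | [set` `]_, +oo[] (X n.+1 z)] = [set z | t / theta n.+1 c < X n.+1
  z]).
  rewrite (prob_gt_tail (cdfX nN')) ler_wpM2r ?(ltW (tail_gt0 long _))//.
  by rewrite mulrC -ler_pdivlMr// H2// big.
by apply/seteqP; split => z /=; rewrite in_itv/= andbT.
Qed.

(** Bonferroni: adding one event at a time, only its overlap with the union of
    the earlier ones is lost. *)
Lemma sum_of_tails_le_some_gt e : 0 < e -> exists t1, forall t, t1 <= t ->
  (1 - e) * sum_of_tails t <= prob P (some_gt t N).
Proof.
move=> e0; have [t1 H1] := overlap_le e0; exists t1 => t tt.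
rewrite /sum_of_tails; have : (N <= N)%N by [].
elim: {1 3 4}N => [|n IH] nN; first by rewrite big_geq// mulr0 prob_ge0.
rewrite big_nat_recr//= mulrDr.
have nN1 : (1 <= n.+1 <= N)%N by [].
have := H1 t tt n.+1 nN1; rewrite [n.+1.-1]/=.
have := IH (ltnW nN).
have m1 : measurable [set z | t < wX n.+1 z] by exact: mgt.
have m2 := measurable_some_gt t n.
have := prob_split P m1 m2.
have := prob_split P (measurable_some_gt t n.+1) m2.
rewrite (_ : some_gt t n.+1 `&` some_gt t n = some_gt t n); last first.
  by rewrite some_gtS; apply/seteqP; split => z; [case|split; [left|]].
rewrite (_ : some_gt t n.+1 `\` some_gt t n = [set z | t < wX n.+1 z] `\` some_gt t n);
  last first.
  by rewrite some_gtS; apply/seteqP; split => z; [case=> -[]|case=> + ?; split; [right|]].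
by lra.
Qed.

Lemma max_asymp e : 0 < e -> e <= 1 -> exists t1, forall t, t1 <= t ->
  [/\ 0 < sum_of_tails t, prob P (some_gt t N) <= (1 + e) * sum_of_tails t &
      sum_of_tails t <= (1 + e) * prob P (some_gt t N)].
Proof.
move=> e0 e1; have [t1 H1] := @sum_of_tails_le_some_gt (e / 2) ltac:(lra).
exists (Num.max t1 0) => t; rewrite ge_max => /andP[tt t_0].
have D0 := sum_of_tails_gt0 t_0; split=> //.
  apply: (@le_trans _ _ (sum_of_tails t)); last by rewrite ler_peMl; lra.
  by apply: prob_sum => // z [i iN tX]; exists i.
apply: (le_trans _ (ler_wpM2l _ (H1 t tt))); last lra.
by rewrite mulrA ler_peMl ?(ltW D0)//; nra.
Qed.

(** Discard the weights below [eta].  For a weight [c] above [eta], the shift of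
    [t / c] is [K * h t / c], and [h t] is at most [max b 1 * h (t / c)] because
    [h] is nondecreasing and [h t / t] is nonincreasing; so the tail is
    evaluated at a shift by a fixed multiple of [h (t / c)]. *)
Lemma sum_of_tails_shift h K e : H_class F h ->
  (forall K' e' : R, 0 < e' -> exists t1, forall t, t1 <= t ->
     tail F t <= (1 + e') * tail F (t + K' * h t)) ->
  0 <= K -> 0 < e ->
  exists t1, forall t, t1 <= t ->
  (1 - e) * sum_of_tails t <= (1 + e) * sum_of_tails (t + K * h t).
Proof.
move=> [hnd /cvgryPge/(_ 0)[t2 [_ hpos]] hdec _ _] hins K0 e0.
have [eta eta0 small] := small_weights e0.
pose b1 := Num.max b 1.
have b11 : 1 <= b1 by rewrite le_max lexx orbT.
have bb1 : b <= b1 by rewrite le_max lexx.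
have [t1 H1] := hins (K * b1 / eta) e e0.
exists (Num.max (b * `|t1|) (Num.max (t2 + 1) 1)) => t; rewrite !ge_max => /and3P[tt tt2
  t1'].
have ht0 : 0 <= h t by apply: hpos; rewrite (lt_le_trans _ tt2)// ltrDl.
have t_0 : 0 < t by exact: lt_le_trans t1'.
rewrite /sum_of_tails !mulr_sumr !big_nat; apply: ler_sum => i iN.
have m1 : measurable [set p : T1 * T2 | eta < theta i p.1 /\ t < theta i p.1 * Y i p.2].
  by apply: measurable_andset; apply: measurable_ltset => //; exact: measurable_funM.
have := @indep_wX_le i _ (1 + e) (t + K * h t) iN m1 ltac:(lra) _.
have -> : [set z | [set p : T1 * T2 | eta < theta i p.1 /\ t < theta i p.1 * Y i p.2] (f1
  z, f2 z)]
  = [set z | eta < theta i (f1 z) /\ t < wX i z].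
  by apply/seteqP; split => z /=; rewrite /wX XY.
have := wX_gt_small iN e0 eta0 (small i iN) (ltW t_0).
move=> h1 h2; have {h2} : prob P [set z | eta < theta i (f1 z) /\ t < wX i z] <=
     (1 + e) * prob P [set z | t + K * h t < wX i z].
  apply: h2 => c.
  have c0 := theta_gt0 i c; have cb := theta_le i c.
  have [etac|etac] := ltP eta (theta i c); last first.
    rewrite [X in prob _ X](_ : _ = set0).
      rewrite /prob measure0 mulr_ge0 ?(ltW (tail_gt0 long _))//; lra.
    by apply/seteqP; split => // z [/=]; rewrite ltNge etac.
  rewrite [X in prob _ X](_ : _ = [set z | t < theta i c * Y i (f2 z)]); last first.
    by apply/seteqP; split => z /=; [case|split].
  rewrite prob_scaled_gt//.
  have sb : t / b <= t / theta i c by rewrite ler_wpM2l ?(ltW t_0)// lef_pV2 ?posrE.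
  have s0 : 0 < t / theta i c by rewrite divr_gt0.
  apply: le_trans (H1 _ _) _.
    apply: le_trans sb; rewrite ler_pdivlMr// (le_trans _ tt)// mulrC.
    by rewrite ler_wpM2l ?ler_norm// ltW.
  rewrite ler_wpM2l//; first lra.
  apply: (le_tail ndF); rewrite mulrDl lerD2l.
  have hs0 : h t <= b1 * h (t / theta i c).
    apply: (@le_trans _ _ (h (b1 * (t / theta i c)))).
      apply: hnd; first exact: ltW.
      by rewrite mulrCA ler_peMr ?(ltW t_0)// ler_pdivlMr// mul1r (le_trans cb).
    have := hdec (t / theta i c) (b1 * (t / theta i c)) s0 ltac:(rewrite ler_peMl//
      ltW//).
    have b10 : 0 < b1 by exact: lt_le_trans b11.
    rewrite ler_pdivrMr ?(mulr_gt0 b10 s0)// => /le_trans; apply.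
    have cancel x y : x != 0 -> y / x * (b1 * x) = b1 * y by move=> x0; field.
    by rewrite cancel// gt_eqF.
  apply: (@le_trans _ _ (K * h t / eta)).
    rewrite ler_wpM2l ?mulr_ge0//.
    by rewrite lef_pV2 ?posrE// ltW.
  rewrite mulrAC [K * b1 / eta]mulrAC -[leRHS]mulrA.
  by rewrite ler_wpM2l// divr_ge0// ltW.
move: h1; lra.
Qed.

(** For a constant weight this is the left tail assumption, whose uniformity in
    the weight allows the integration. *)
Lemma left_part_le h e : H_class F h -> 0 < e ->
  exists t1, forall t, t1 <= t -> forall i, (1 <= i <= N)%N ->
  prob P [set z | wX i z < - h t] <= e * prob P [set z | t < wX i z].
Proof.
move=> Hh e0; have /fine_cvgP[[t1 [_ fin]] /cvgrPdist_le/(_ e e0)[t2 [_ sup]]] := Fleft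
  b0 Hh.
exists (Num.max (t1 + 1) (t2 + 1)) => t; rewrite ge_max => /andP[tt1 tt2] i iN.
have {}fin := fin t ltac:(lra).
have {sup} := sup t ltac:(lra); rewrite /= sub0r normrN => /(le_trans (ler_norm _)) sup.
have m1 : measurable [set p : T1 * T2 | theta i p.1 * Y i p.2 < - h t].
  by apply: measurable_ltset => //; exact: measurable_funM.
have := indep_wX_le (t := t) iN m1 (ltW e0).
rewrite (_ : [set z | [set p : T1 * T2 | theta i p.1 * Y i p.2 < - h t] (f1 z, f2 z)] =
  [set z | wX i z < - h t]); last by apply/seteqP; split => z /=; rewrite /wX XY.
apply=> c; have c0 := theta_gt0 i c; have cb := theta_le i c.
apply: (@le_trans _ _ (F (- h t / theta i c))).
  rewrite -(prob_le_cdf (cdfX iN)); apply: le_prob.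
  - rewrite (_ : [set z | _] = [set z | theta i c * X i z < - h t]).
      by apply: measurable_ltset => //; exact: measurable_funM.
    by apply/seteqP; split => z /=; rewrite XY.
  - exact: measurable_leset.
  by move=> z /=; rewrite XY// ler_pdivlMr// mulrC => /ltW.
rewrite -ler_pdivrMr ?tail_gt0// (le_trans _ sup)// -lee_fin fineK//.
apply: ereal_sup_ubound; exists (theta i c) => //=.
by rewrite in_itv/= c0.
Qed.

(** If one term exceeds [t + N * h t] and all terms are at least [- h t], then
    the sum exceeds [t]. *)
Lemma sum_asymp e : 0 < e -> e <= 1 -> exists t1, forall t, t1 <= t ->
  [/\ 0 < sum_of_tails t, prob P [set z | t < \sum_(1 <= i < N.+1) wX i z] <= (1 + e) *
    sum_of_tails t &
      sum_of_tails t <= (1 + e) * prob P [set z | t < \sum_(1 <= i < N.+1) wX i z]].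
Proof.
move=> e0 e1; have [t1 H1] := sum_upper e0.
have [h [Hh hins]] := insensitive_function ndF long.
(* A margin that absorbs the losses: [(1 + e) * (1 - 3 * k)] is at least
   [1 + k]. *)
pose k := e / 20.
have k0 : 0 < k by rewrite divr_gt0.
have ke : e = 20 * k by rewrite /k; field.
clearbody k.
have [t2 H2] := sum_of_tails_le_some_gt k0.
have [t3 H3] := sum_of_tails_shift Hh hins (ler0n R N) k0.
have [t4 H4] := left_part_le Hh k0.
have [_ /cvgryPge/(_ 0)[t5 [_ hpos]] _ _ _] := Hh.
exists (Num.max (Num.max t1 t2) (Num.max (Num.max t3 t4) (Num.max (t5 + 1) 0))) => t.
rewrite !ge_max => /andP[/andP[tt1 tt2] /andP[/andP[tt3 tt4] /andP[tt5 t_0]]].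
have ht0 : 0 <= h t by apply: hpos; rewrite (lt_le_trans _ tt5)// ltrDl.
have D0 := sum_of_tails_gt0 t_0; split; [exact: D0|exact: H1|].
pose t' := t + N%:R * h t.
have tt' : t <= t' by rewrite lerDl mulr_ge0.
pose B := [set z | t < \sum_(1 <= i < N.+1) wX i z].
have mB : measurable B.
  by apply: measurable_ltset => //; apply: measurable_sum; exact: measurable_wX.
have mU := measurable_some_gt t' N.
have split_le : prob P (some_gt t' N) <= prob P B + k * sum_of_tails t.
  rewrite (prob_split P mU mB) lerD//.
    by apply: le_prob => //; exact: measurableI.
  rewrite /sum_of_tails mulr_sumr.
  apply: (@le_trans _ _ (\sum_(1 <= i < N.+1) prob P [set z | wX i z < - h t])).
    apply: prob_sum.
    - by move=> i; apply: measurable_ltset => //; exact: measurable_wX.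
    - exact: measurableD.
    move=> z [[i iN tX] nB]; apply: contrapT => H; apply: nB.
    have hX j : (1 <= j <= N)%N -> 0 <= wX j z + h t.
      move=> jN; rewrite -lerBlDr sub0r leNgt; apply/negP => Xj.
      by apply: H; exists j.
    have : wX i z + h t <= \sum_(1 <= j < N.+1) (wX j z + h t).
      rewrite (bigD1_seq i) ?mem_index_iota ?iota_uniq//= lerDl big_nat_cond.
      by apply: sumr_ge0 => j /andP[jN _]; exact: hX.
    rewrite big_split/= big_const_nat iter_addr_0 subn1/= -mulr_natl.
    rewrite /B/= -(ltrD2r (N%:R * h t)); apply: lt_le_trans.
    by rewrite (lt_le_trans tX)// lerDl.
  by rewrite !big_nat; apply: ler_sum => i iN; exact: H4.
have := H2 t' (le_trans tt2 tt'); have := H3 t tt3; rewrite -/t'.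
move: split_le D0; move: (sum_of_tails t) (sum_of_tails t') (prob P B) (prob P _) => D D'
  p pu.
clearbody t' => s1 s2 s3 s4.
have k1 : k <= 1 / 20 by lra.
have p0 : (1 - 3 * k) * D <= (1 + k) * p.
  have a1 : (1 - k) * ((1 - k) * D) <= (1 - k) * ((1 + k) * D').
    by rewrite ler_wpM2l//; lra.
  have a2 : (1 + k) * ((1 - k) * D') <= (1 + k) * (p + k * D).
    by rewrite ler_wpM2l//; lra.
  by lra.
have k2 : k * k <= k * (1 / 20) by rewrite ler_wpM2l// ltW.
have a3 : (1 + e) * ((1 - 3 * k) * D) <= (1 + e) * ((1 + k) * p) by rewrite ler_wpM2l//;
  lra.
have a4 : 1 + k <= (1 + e) * (1 - 3 * k) by rewrite ke; lra.
have a5 : (1 + k) * D <= (1 + e) * (1 - 3 * k) * D by rewrite ler_wpM2r// ltW.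
rewrite -(@ler_pM2l _ (1 + k)); last lra.
by rewrite (le_trans a5)// -mulrA (le_trans a3)// mulrCA.
Qed.

End core.

(** * Marginal laws and the dependence assumption *)

Section tail_inverse.
Context (R : realType) (F : cumulativeBounded (0 : R) (1 : R)).
Hypothesis tail_pos : forall s, 0 < tail F s.

Let ndF : {homo F : x y / x <= y}.
Proof. exact: cumulative_is_nondecreasing. Qed.

Let F_ge0 x : 0 <= F x.
Proof.
rewrite leNgt; apply/negP => Fx.
have /cvgrPdist_lt/(_ (- F x)) := cumulativeNy F; rewrite oppr_gt0 => /(_ Fx)[M [_ H]].
have := H (Num.min (M - 1) x); rewrite gt_min ltrBlDr ltrDl ltr01 => /(_ isT) /=.
have : F (Num.min (M - 1) x) <= F x by apply: ndF; rewrite ge_min lexx orbT.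
move=> h; rewrite sub0r normrN ltr0_norm; first lra.
exact: le_lt_trans Fx.
Qed.

(** The Galois connection between a distribution function and its generalized
    inverse, for tails. *)
Lemma tail_inv_le u x : 0 < u < 1 -> (tail_inv F u <= x) = (tail F x <= u).
Proof.
move=> /andP[u0 u1].
have lb : has_lbound [set y | tail F y <= u].
  have /cvgrPdist_lt/(_ (1 - u)) := cumulativeNy F; rewrite subr_gt0 => /(_ u1)[M [_ H]].
  exists (M - 1) => y /=; rewrite /tail => yu; rewrite leNgt; apply/negP => yM.
  have := H y ltac:(by rewrite (lt_trans yM)// ltrBlDr ltrDl) => /=.
  by rewrite sub0r normrN ger0_norm//; lra.
have ne : [set y | tail F y <= u] !=set0.
  have /cvgrPdist_lt/(_ u u0)[M [_ H]] := cumulativey F.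
  exists (M + 1) => /=; have := H (M + 1) ltac:(by rewrite ltrDl).
  by move=> /(le_lt_trans (ler_norm _)) /ltW.
apply/idP/idP => [ux|]; last by move=> xu; exact: ge_inf.
have right y : x < y -> tail F y <= u.
  move=> /(le_lt_trans ux) /(inf_lt ne)[v /= vu vy].
  by apply: le_trans vu; rewrite /tail lerD2l lerN2 ndF// ltW.
rewrite leNgt; apply/negP => utx.
have /cvgrPdist_lt/(_ (tail F x - u)) := cumulative_is_right_continuous F x.
rewrite subr_gt0 => /(_ utx) [e /= e0 H].
have := H (x + e / 2); rewrite /ball/= opprD addrA subrr sub0r normrN gtr0_norm
  ?divr_gt0//.
have := right (x + e / 2); rewrite ltrDl divr_gt0// => /(_ isT) h1 /(_ _ _) h2.
have : `|F x - F (x + e / 2)| < tail F x - u by apply: h2; lra.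
by rewrite distrC => /(le_lt_trans (ler_norm _)); move: h1; rewrite /tail; lra.
Qed.

Lemma uniform_prob_itv (a : R) : 0 < a <= 1 ->
  uniform_prob (@ltr01 R) `[a, 1[%classic = (1 - a)%:E.
Proof.
move=> /andP[a0 a1]; rewrite /uniform_prob.
rewrite (eq_integral (fun=> 1%E)); last first.
  move=> x; rewrite inE/= in_itv/= => /andP[ax x1].
  by rewrite /uniform_pdf (le_trans (ltW a0) ax) (ltW x1)/= subr0 invr1.
rewrite integral_cst//= mul1e lebesgue_measure_itv/= lte_fin.
by case: ltP => // a1'; rewrite (_ : a = 1) ?subrr//; apply/eqP; rewrite eq_le a1.
Qed.

Lemma cdf_tail_inv d (T : measurableType d) (P : probability T R) (U X : {RV P >-> R}) :
  (forall A, measurable A -> distribution P U A = uniform_prob (@ltr01 R) A) ->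
  (forall z, X z = tail_inv F (U z)) ->
  forall x, cdf X x = (F x)%:E.
Proof.
move=> uni XE x.
have p1 : prob P [set z | X z <= x] = F x.
  have mU A : measurable A -> measurable (U @^-1` A).
    by move=> mA; rewrite -[_ @^-1` _]setTI; exact: measurable_funPT.
  have t01 : 0 < tail F x <= 1 by rewrite tail_pos /tail gerBl F_ge0.
  transitivity (prob P (U @^-1` `[tail F x, 1[%classic)); last first.
    have := uni `[tail F x, 1[%classic (measurable_itv _); rewrite uniform_prob_itv//.
    by rewrite /prob /distribution /pushforward => -> /=; rewrite /tail; lra.
  apply: eq_prob_ae; [exact: measurable_leset|exact: mU|].
  exists (~` (U @^-1` `]0, 1[%classic)); split.
  - by apply: measurableC; exact: mU.
  - rewrite probability_setC; last exact: mU.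
    have -> : P (U @^-1` `]0, 1[%classic) = uniform_prob (@ltr01 R) `]0, 1[%classic.
      exact: uni.
    rewrite /uniform_prob (eq_integral (fun=> 1%E)); last first.
      move=> y; rewrite inE/= in_itv/= => /andP[ax x1].
      by rewrite /uniform_pdf (ltW ax) (ltW x1)/= subr0 invr1.
    by rewrite integral_cst//= mul1e lebesgue_measure_itv/= lte_fin ltr01 oppr0 adde0
      subee.
  move=> z /=; apply: contra_not; rewrite !in_itv/= => /andP[u0 u1].
  by rewrite u1 andbT XE tail_inv_le// u0.
rewrite -p1 -probE; last exact: measurable_leset.
by rewrite /cdf /distribution /pushforward; congr (P _); apply/seteqP; split => z /=;
  rewrite in_itv.
Qed.

End tail_inverse.

(** Integrated form of the conditional bound: at [X j = x], the level [s] is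
    [t - x] for [t = x + s].  The version of the conditional law no longer
    occurs. *)
Lemma cond_tail_bound_quasi_indep (R : realType) d (T : measurableType d) (P :
  probability T R)
    (m : nat) (X : nat -> {RV P >-> R}) : cond_tail_bound m X ->
  exists t0 M : R, 0 < M /\
  forall j, (2 <= j <= m.+1)%N -> forall s (B : set R), 0 < s ->
  measurable B -> B `<=` `[t0, +oo[%classic ->
  prob P [set z | s < pos_sum (fun i => X i) j z /\ B (X j z)] <=
  M * prob P [set z | s < pos_sum (fun i => X i) j z] * prob P [set z | B (X j z)].
Proof.
move=> [t0 [M [t00 M0 H]]]; exists t0, M; split=> // j jm s B s0 mB Bt0.
have [K [HK Ksup]] := H j jm.
have mS := measurable_pos_sum X j.
have mgS : measurable [set z | s < pos_sum (fun i => X i) j z] by exact: measurable_ltset.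
have mXB : measurable [set z | B (X j z)].
  by rewrite -[X in measurable X]setTI; exact: measurable_funPT.
have mI : measurable `]s, +oo[%classic by exact: measurable_itv.
have mSB := measurable_andset mgS mXB.
have [S0|S0] := eqVneq (prob P [set z | s < pos_sum (fun i => X i) j z]) 0.
  rewrite S0 mulr0 mul0r -S0; apply: le_prob => //; by move=> z [].
have Spos : 0 < prob P [set z | s < pos_sum (fun i => X i) j z].
  by rewrite lt_neqAle eq_sym S0 prob_ge0.
set pS := prob P [set z | s < pos_sum (fun i => X i) j z] in S0 Spos *.
rewrite -lee_fin EFinM -!probE//.
have -> : P [set z | s < pos_sum (fun i => X i) j z /\ B (X j z)] =
   (\int[distribution P (X j)]_(y in B) K y `]s, +oo[%classic)%E.
  rewrite -HK//; congr (P _); apply/seteqP; split => z /=; rewrite in_itv/= andbT//.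
have -> : ((M * pS)%:E * P [set z | B (X j z)])%E =
   (\int[distribution P (X j)]_(y in B) (M * pS)%:E)%E by rewrite integral_cst.
apply: ge0_le_integral => //.
- by apply: measurable_funTS; exact: measurable_kernel.
move=> y By; have yt0 : t0 <= y by have := Bt0 y By; rewrite /= in_itv/= andbT.
have Kfin : K y `]s, +oo[%classic \is a fin_num.
  rewrite ge0_fin_numE//; apply: le_lt_trans (ltry 1).
  by rewrite -(@prob_kernel _ _ _ _ _ K y); apply: le_measure; rewrite ?inE.
rewrite -[leLHS]fineK// lee_fin -ler_pdivrMr// -lee_fin.
apply: le_trans (Ksup (y + s) _); last by rewrite (le_lt_trans yt0)// ltrDl.
apply: ereal_sup_ubound; exists y; first by rewrite /= in_itv/= yt0 lerDl ltW.
by rewrite addrAC subrr add0r.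
Qed.

(** * The weights of the statement *)

Lemma lt_max_from_to (R : realType) (a c : nat) (f : nat -> R) (t : R) : (a <= c)%N ->
  t < max_from_to a c f <-> exists2 i, (a <= i <= c)%N & t < f i.
Proof.
move=> ac; rewrite /max_from_to.
have -> : (t < \big[Num.max/f a]_(a <= i < c.+1) f i) =
    (t < f a) || has (fun i => t < f i) (index_iota a c.+1).
  elim: (index_iota a c.+1) => [|i r IH]; first by rewrite big_nil orbF.
  by rewrite big_cons lt_max IH orbCA.
split.
  move=> /orP[ta|/hasP[i]]; first by exists a; rewrite ?leqnn.
  by rewrite mem_index_iota ltnS; exists i.
by move=> [i iac ti]; apply/orP; right; apply/hasP; exists i; rewrite ?mem_index_iota
  ?ltnS.
Qed.

Lemma measurable_max_from_to (R : realType) d (T : measurableType d) (a c : nat)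
  (f : nat -> T -> R) : (forall i, measurable_fun setT (f i)) ->
  measurable_fun setT (fun z => max_from_to a c (fun i => f i z)).
Proof.
move=> mf; rewrite /max_from_to; elim: (index_iota a c.+1) => [|i r IH].
  by under eq_fun do rewrite big_nil; exact: mf.
under eq_fun do rewrite big_cons.
exact: measurable_maxr.
Qed.

Section sigma_family.
Context (R : realType) d (T : measurableType d) (n : nat).

Definition family_gen (Z : nat -> T -> R) : set (set T) :=
  \bigcup_(i in [set i | (1 <= i <= n)%N]) preimage_set_system setT (Z i) measurable.

Lemma sigma_family_measurable (Z : nat -> T -> R) :
  (forall i, (1 <= i <= n)%N -> measurable_fun setT (Z i)) ->
  <<s family_gen Z >> `<=` measurable.
Proof.
move=> mZ; apply: smallest_sub; first exact: sigma_algebra_measurable.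
by move=> A [i /= iN [B mB <-]]; exact: mZ.
Qed.

Lemma measurable_family (Z : nat -> T -> R) i : (1 <= i <= n)%N ->
  measurable_fun (setT : set (g_sigma_algebraType (family_gen Z))) (Z i).
Proof.
by move=> iN _ B mB; apply: sub_sigma_algebra; exists i => //; exists B.
Qed.

End sigma_family.

Section weighted.
Context (R : realType) d (T : measurableType d) (P : probability T R) (n m : nat).
Variables (F : R -> R) (X w : nat -> {RV P >-> R}).
Hypothesis mn : (m < n)%N.
Hypothesis Fsub : subexponential F.
Hypothesis cdfX : forall i, (1 <= i <= n)%N -> forall x, cdf (X i) x = (F x)%:E.
Hypothesis ha : cond_tail_bound m X.
Hypothesis hc : left_tail_negligible F.
Hypothesis w_indep : independent_families P n (fun i => w i) (fun i => X i).

Let Gw := family_gen n (fun i => w i : T -> R).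
Let GX := family_gen n (fun i => X i : T -> R).
Local Notation T1 := (g_sigma_algebraType Gw).
Local Notation T2 := (g_sigma_algebraType GX).

Let id1 (z : T) : T1 := z.
Let id2 (z : T) : T2 := z.

Let mid1 : measurable_fun setT id1.
Proof.
move=> _ A mA; rewrite setTI; apply: (sigma_family_measurable _ mA) => i _.
exact: measurable_funPT.
Qed.
Let mid2 : measurable_fun setT id2.
Proof.
move=> _ A mA; rewrite setTI; apply: (sigma_family_measurable _ mA) => i _.
exact: measurable_funPT.
Qed.
HB.instance Definition _ := @isMeasurableFun.Build _ _ _ _ id1 mid1.
HB.instance Definition _ := @isMeasurableFun.Build _ _ _ _ id2 mid2.

Let indep_id (A : set T1) (B : set T2) : measurable A -> measurable B ->
  P (id1 @^-1` A `&` id2 @^-1` B) = (P (id1 @^-1` A) * P (id2 @^-1` B))%E.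
Proof. by move=> mA mB; exact: w_indep. Qed.

(** The weights modified on a null set so as to lie in (0, 1) everywhere; the
    estimates for frozen weights then need no exceptional set. *)
Definition clipped i (z : T) : R :=
  if (1 <= i <= n)%N then (if 0 < w i z < 1 then w i z else 2^-1) else 2^-1.

Lemma clipped_itv i z : 0 < clipped i z < 1.
Proof.
rewrite /clipped; case: ifP => _; last by apply/andP; split; lra.
by case: ifP => // _; apply/andP; split; lra.
Qed.

Lemma measurable_clipped i : measurable_fun (setT : set T1) (clipped i).
Proof.
rewrite /clipped; case iN : (1 <= i <= n)%N => //.
have mw := @measurable_family _ _ _ n (fun i => w i : T -> R) _ iN.
apply: measurable_fun_ifT => //; apply: measurable_and; apply: measurable_fun_ltr => //.
Qed.

Section combined.
Variable g : T -> R.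
Hypothesis mg : measurable_fun (setT : set T1) g.
Hypothesis g_gt0 : forall z, 0 < g z.
Variable b : R.
Hypothesis g_le : forall z, g z <= b.

Let theta i : T1 -> R := if (i <= m)%N then clipped i else g.
Let Y i : T2 -> R := if (1 <= i <= n)%N then X i : T -> R else cst 0.

(** Independence is used with the identity map into two copies of [T], carrying
    the sigma-algebras of the weights and of the variables; freezing the weights
    is then freezing a point of the first copy. *)
Lemma weighted_asymp :
  let D t := \sum_(1 <= i < m.+1) prob P [set z | t < clipped i z * X i z]
             + prob P [set z | t < g z * X m.+1 z] in
  asymp_equiv (fun t => prob P [set z | t <
     \sum_(1 <= i < m.+1) clipped i z * X i z + g z * X m.+1 z]) D /\
  asymp_equiv (fun t => prob P [set z | (exists2 i, (1 <= i <= m)%N & t < clipped i z * X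
    i z)
     \/ t < g z * X m.+1 z]) D.
Proof.
have [t0 [M [M0 quasi_indep]]] := cond_tail_bound_quasi_indep ha.
have mtheta i : measurable_fun setT (theta i).
  by rewrite /theta; case: ifP => // _; exact: measurable_clipped.
have mY i : measurable_fun setT (Y i).
  by rewrite /Y; case iN: (1 <= i <= n)%N => //; exact: (@measurable_family _ _ _ n (fun
    i => X i : T -> R) _ iN).
have XY i z : (1 <= i <= m.+1)%N -> X i z = Y i (id2 z).
  by move=> /andP[i1 im]; rewrite /Y i1 (leq_trans im mn).
have theta0 i c : 0 < theta i c.
  by rewrite /theta; case: ifP => // _; have /andP[] := clipped_itv i c.
have theta_le i c : theta i c <= Num.max b 1.
  rewrite /theta le_max; case: ifP => _; last by rewrite g_le.
  by have /andP[_ /ltW ->] := clipped_itv i c; rewrite orbT.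
have b0 : 0 < Num.max b 1 by rewrite lt_max ltr01 orbT.
have cdfXm i : (1 <= i <= m.+1)%N -> forall x, cdf (X i) x = (F x)%:E.
  by move=> /andP[i1 im]; apply: cdfX; rewrite i1 (leq_trans im mn).
have HS := sum_asymp indep_id (ltn0Sn m) mtheta mY XY theta0 theta_le b0 cdfXm Fsub M0
  quasi_indep hc.
have HM := max_asymp indep_id (ltn0Sn m) mtheta mY XY theta0 theta_le b0 cdfXm Fsub M0
  quasi_indep.
have wXE i z : (i <= m)%N -> wX id1 theta X i z = clipped i z * X i z.
  by move=> im; rewrite /wX /theta im.
have wXl z : wX id1 theta X m.+1 z = g z * X m.+1 z by rewrite /wX /theta ltnn.
have DE t : sum_of_tails id1 m.+1 theta X t = \sum_(1 <= i < m.+1) prob P [set z | t <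
  clipped i z * X i z]
             + prob P [set z | t < g z * X m.+1 z].
  rewrite /sum_of_tails big_nat_recr//=; congr +%R; last first.
    by congr prob; apply/seteqP; split => z /=; rewrite wXl.
  apply: eq_big_nat => i /andP[_ im]; congr prob; apply/seteqP; split => z /=; by rewrite
    wXE.
have sumE z : \sum_(1 <= i < m.+2) wX id1 theta X i z =
    \sum_(1 <= i < m.+1) clipped i z * X i z + g z * X m.+1 z.
  rewrite big_nat_recr//= wXl; congr +%R.
  by apply: eq_big_nat => i /andP[_ im]; rewrite wXE.
split; apply: asymp_equiv_squeeze => e e0 e1.
  have [t1 H] := HS e e0 e1; exists t1 => t /H; rewrite -DE.
  by rewrite (_ : [set z | t < \sum_(1 <= i < m.+2) wX id1 theta X i z] = [set z | t <
    \sum_(1 <= i < m.+1) clipped i z * X i z + g z * X m.+1 z])//;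
    apply/seteqP; split => z /=; rewrite sumE.
have [t1 H] := HM e e0 e1; exists t1 => t /H; rewrite -DE.
have -> // : some_gt id1 theta X t m.+1 = [set z | (exists2 i, (1 <= i <= m)%N & t <
  clipped i z * X i z)
     \/ t < g z * X m.+1 z].
apply/seteqP; split => z /=.
  move=> [i /andP[i1]]; rewrite leq_eqVlt => /orP[/eqP ->|im]; first by rewrite wXl;
    right.
  by rewrite wXE// => tX; left; exists i; rewrite ?i1.
move=> [[i /andP[i1 im] tX]|tX]; last by exists m.+1; rewrite ?leqnn ?wXl.
by exists i; rewrite ?wXE// i1 ltnW.
Qed.

End combined.
End weighted.

Lemma asymp_equiv_eq_ge0 (R : realType) (f f' g g' : R -> R) :
  (forall t, 0 <= t -> f t = f' t) -> (forall t, 0 <= t -> g t = g' t) ->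
  asymp_equiv f' g' -> asymp_equiv f g.
Proof.
move=> ff gg; apply: cvg_trans; apply: near_eq_cvg.
by exists 0; split => // t /ltW t0; rewrite ff// gg.
Qed.

Theorem theorem3p6 (R : realType) (d : measure_display) (T : measurableType d)
    (P : probability T R) (n m : nat)
    (F : cumulativeBounded (0 : R) (1 : R))
    (U X w : nat -> {RV P >-> R})
    (hn : (2 <= n)%N) (hnm : (2 <= n - m)%N)
    (F_continuous : continuous F)
    (F_subexponential : subexponential F)
    (U_uniform : forall i, (1 <= i <= n)%N ->
       forall A, measurable A ->
         distribution P (U i) A = uniform_prob (@ltr01 R) A)
    (U_common : forall i, (m.+1 <= i <= n)%N ->
       {ae P, forall z, U i z = U m.+1 z})
    (X_def : forall i, (1 <= i <= n)%N ->
       forall z, X i z = tail_inv F (U i z))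
    (ha : cond_tail_bound m X)
    (w_range : forall i, (1 <= i <= n)%N ->
       P [set z | 0 < w i z < 1] = 1%E)
    (w_mean : (\sum_(1 <= i < n.+1) 'E_P[w i] = 1)%E)
    (w_indep : independent_families P n (fun i => w i) (fun i => X i))
    (hc : left_tail_negligible F) :
  asymp_equiv
    (fun t => prob P [set z | t < \sum_(1 <= i < n.+1) w i z * X i z])
    (fun t =>
       \sum_(1 <= i < m.+1) prob P [set z | t < w i z * X i z]
       + prob P [set z | t < (\sum_(m.+1 <= i < n.+1) w i z) * X m.+1 z])
  /\
  asymp_equiv
    (fun t => prob P [set z | t < max_from_to 1 n (fun i => w i z * X i z)])
    (fun t =>
       \sum_(1 <= i < m.+1) prob P [set z | t < w i z * X i z]
       + prob P [set z | t < max_from_to m.+1 n (fun i => w i z) * X m.+1 z]).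
Proof.
have [Flong _] := F_subexponential.
have cdfX i : (1 <= i <= n)%N -> forall x, cdf (X i) x = (F x)%:E.
  by move=> iN; apply: (cdf_tail_inv Flong.1 (U_uniform i iN)); exact: X_def.
have mn : (m < n)%N by rewrite -subn_gt0 (leq_trans _ hnm).
pose W := clipped n w.
have mW i : measurable_fun setT (W i).
  rewrite /W /clipped; case: (1 <= i <= n)%N => //.
  by apply: measurable_fun_ifT => //; apply: measurable_and; apply: measurable_fun_ltr.
have mWX i j : measurable_fun setT (fun z => W i z * X j z) by exact: measurable_funM.
have mwX i j : measurable_fun setT (fun z => w i z * X j z) by exact: measurable_funM.
have W_w : {ae P, forall z, forall i, (1 <= i <= n)%N -> W i z = w i z}.
  apply: ae_foralln => i; case iN : (1 <= i <= n)%N; last first.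
    by exists set0; split => // z /=; apply; exact.
  have m01 : measurable [set z | 0 < w i z < 1].
    rewrite (_ : [set z | _] = [set z | 0 < w i z /\ w i z < 1]).
      by apply: measurable_andset; exact: measurable_ltset.
    by apply/seteqP; split => z /andP.
  exists (~` [set z | 0 < w i z < 1]); split; first exact: measurableC.
    by have := probability_setC P m01; rewrite w_range// subee.
  move=> z /=; apply: contra_not => w01 _; by rewrite /W /clipped iN w01.
have X_X : {ae P, forall z, forall i, (m.+1 <= i <= n)%N -> X i z = X m.+1 z}.
  apply: ae_foralln => i; case iN : (m.+1 <= i <= n)%N; last first.
    by exists set0; split => // z /=; apply; exact.
  have mi : (1 <= i <= n)%N by move/andP: iN => [mi ->]; rewrite (leq_ltn_trans _ mi).
  have mm : (1 <= m.+1 <= n)%N by rewrite mn.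
  by apply: filterS (U_common i iN) => z Uz _; rewrite !X_def// Uz.
have terms t i : (1 <= i < m.+1)%N ->
    prob P [set z | t < w i z * X i z] = prob P [set z | t < W i z * X i z].
  move=> /andP[i1 im]; apply: eq_prob_ae; [exact: measurable_ltset|exact:
    measurable_ltset|].
  by apply: filterS W_w => z Wz /=; rewrite Wz// i1 (ltnW (leq_trans im mn)).
have sums t : \sum_(1 <= i < m.+1) prob P [set z | t < w i z * X i z] =
    \sum_(1 <= i < m.+1) prob P [set z | t < W i z * X i z].
  by apply: eq_big_nat => i; exact: terms.
have in_n i : (m.+1 <= i)%N -> (i <= n)%N -> (1 <= i <= n)%N.
  by move=> mi ->; rewrite (leq_ltn_trans _ mi).
have mWT i := @measurable_clipped _ _ _ P n w i.
split.
- pose g z := \sum_(m.+1 <= i < n.+1) W i z.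
  have g0 z : 0 < g z.
    rewrite /g big_ltn// ltr_wpDr//.
      by apply: sumr_ge0 => i _; have /andP[/ltW] := clipped_itv n w i z.
    by have /andP[] := clipped_itv n w m.+1 z.
  have gn z : g z <= n.+1%:R.
    apply: (@le_trans _ _ (\sum_(m.+1 <= i < n.+1) 1)).
      by apply: ler_sum => i _; have /andP[_ /ltW] := clipped_itv n w i z.
    by rewrite big_const_nat iter_addr_0 ler_nat leq_subr.
  have mg : measurable_fun setT g by exact: measurable_sum.
  have [H _] := weighted_asymp mn F_subexponential cdfX ha hc w_indep (measurable_sum _
    mWT) g0 gn.
  move: H; apply: asymp_equiv_eq_ge0 => t _.
  + apply: eq_prob_ae.
    * by apply: measurable_ltset => //; exact: measurable_sum.
    * apply: measurable_ltset => //; apply: measurable_funD; first exact: measurable_sum.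
      exact: measurable_funM.
    apply: filterS2 W_w X_X => z Wz Xz /=.
    rewrite (@big_cat_nat _ _ _ m.+1)//=; last exact: ltnW.
    rewrite (_ : \sum_(m.+1 <= i < n.+1) w i z * X i z = g z * X m.+1 z); last first.
      rewrite /g mulr_suml; apply: eq_big_nat => i /andP[mi iN].
      by rewrite Wz ?in_n// Xz// mi.
    rewrite (_ : \sum_(1 <= i < m.+1) w i z * X i z = \sum_(1 <= i < m.+1) W i z * X i
      z)//.
    apply: eq_big_nat => i /andP[i1 im].
    by rewrite Wz// i1 (ltnW (leq_trans im mn)).
  + rewrite sums; congr +%R; apply: eq_prob_ae.
    * apply: measurable_ltset => //; apply: measurable_funM => //; exact: measurable_sum.
    * by apply: measurable_ltset => //; exact: measurable_funM.
    apply: filterS W_w => z Wz /=.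
    rewrite (_ : \sum_(m.+1 <= i < n.+1) w i z = g z)//.
    by apply: eq_big_nat => i /andP[mi iN]; rewrite Wz ?in_n.
- pose g z := max_from_to m.+1 n (fun i => W i z).
  have g0 z : 0 < g z.
    apply/lt_max_from_to => //; exists m.+1; rewrite ?leqnn ?mn//.
    by have /andP[] := clipped_itv n w m.+1 z.
  have gn z : g z <= 1.
    rewrite leNgt; apply/negP => /lt_max_from_to[]// i _.
    by have /andP[_ /ltW] := clipped_itv n w i z; rewrite leNgt => /negP.
  have mg : measurable_fun setT g by exact: measurable_max_from_to.
  have [_ H] := weighted_asymp mn F_subexponential cdfX ha hc w_indep
    (measurable_max_from_to _ _ mWT) g0 gn.
  move: H; apply: asymp_equiv_eq_ge0 => t t0.
  + apply: eq_prob_ae.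
    * by apply: measurable_ltset => //; apply: measurable_max_from_to => i.
    * apply: measurableU; last by apply: measurable_ltset => //; exact: measurable_funM.
      by apply: measurable_exset => i; exact: measurable_ltset.
    apply: filterS2 W_w X_X => z Wz Xz /=.
    have X_gt0 c i : 0 < c -> t < c * X i z -> 0 < X i z.
      by move=> c0 /(le_lt_trans t0); rewrite pmulr_rgt0.
    have W0 i : 0 < W i z by have /andP[] := clipped_itv n w i z.
    rewrite lt_max_from_to ?(ltnW hn)//; split.
      move=> [i /andP[i1 iN]]; rewrite -Wz ?i1// => tX.
      have [im|mi] := leqP i m; first by left; exists i; rewrite ?i1.
      right; move: tX; rewrite Xz ?mi// => tX; have X0 := X_gt0 _ _ (W0 i) tX.
      rewrite -ltr_pdivrMr//; apply/lt_max_from_to => //; exists i; first by rewrite mi.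
      by rewrite ltr_pdivrMr.
    move=> [[i /andP[i1 im] tX]|tX].
      by exists i; rewrite -?Wz// i1 (leq_trans im (ltnW mn)).
    have X0 := X_gt0 _ _ (g0 z) tX.
    move: tX; rewrite -ltr_pdivrMr// => /lt_max_from_to[]// i /andP[mi iN].
    rewrite ltr_pdivrMr// => tX; exists i; first exact: in_n.
    by rewrite -Wz ?in_n// Xz// mi.
  + rewrite sums; congr +%R; apply: eq_prob_ae.
    * apply: measurable_ltset => //; apply: measurable_funM => //; exact:
      measurable_max_from_to.
    * by apply: measurable_ltset => //; exact: measurable_funM.
    apply: filterS W_w => z Wz /=.
    rewrite (_ : max_from_to m.+1 n (fun i => w i z) = g z)//.
    rewrite /g /max_from_to Wz ?in_n//; apply: eq_big_nat => i /andP[mi iN]; by rewrite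
      Wz ?in_n.
Qed.
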